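(* Algorithm DLE terminates in $O(D_A)$ rounds, i.e., in every fair execution starting from a permitted initial configuration $C_0$, all particles reach a final state within $O(D_A)$ rounds, where $D_A$ is the diameter of $S_P(C_0)$ with respect to distances in the area of $S_P(C_0)$.
   Context: Geometry. The triangular grid $G$ has as vertices (''points'') the points of the regular triangular lattice in the plane, adjacent iff at unit distance; each point has six incident edges, cyclically ordered clockwise. A shape is a finite set of points (identified with its induced subgraph). For a connected shape $S$: the unbounded face is the outer face; a bounded face containing a grid point not in $S$ is a hole, whose grid points are hole points; the area of $S$ is $S$ together with its hole points; the outer boundary is the set of points of $S$ on the boundary of the outer face; a boundary point is a point of $S$ adjacent to a point not in $S$. For shapes $S\subseteq S^*$, $dist_{S^*}(u,v)$ is the length of a shortest path between $u,v$ in the subgraph induced by $S^*$, and the diameter of $S$ w.r.t. $S^*$ is $\max_{u,v\in S} dist_{S^*}(u,v)$. For a boundary point $v$, a local boundary $B$ of $v$ w.r.t. $S$ is a maximal clockwise cyclic interval of consecutive edges at $v$ leading to points not in $S$, with boundary count $c(v,B)=|B|-2$. $v$ is redundant if its neighbors in $S$ induce a connected subgraph; erodable if redundant and on the outer boundary (then it has a single local boundary $B$); SCE if erodable and $c(v,B)>0$. Model (amoebot, strong scheduler). Anonymous constant-memory particles each occupy one point (contracted) or two adjacent points (expanded; head and tail); no point is occupied twice. Each particle labels the edges at its point by ports $0,\dots,5$; all share clockwise chirality, and a particle knows the port a neighbor uses for their common edge. Particles read and write neighbors' memories. A contracted particle may expand into an adjacent unoccupied point (its new head); an expanded one may contract into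 either of its points; handovers allowed. An execution is a sequence of atomic activations of single particles; in an activation a particle reads neighbors' memories, computes, writes its own and neighbors' memories, and performs at most one movement. A particle in a final state does nothing when activated. A fair execution activates every particle infinitely often; a round is a minimal execution fragment in which every particle is activated at least once. A permitted initial configuration $C_0$: all particles contracted, at least one particle, set $S_P(C_0)$ of occupied points connected. Input: each particle knows, for each port $i$, whether the point via port $i$ lies in the outer face of $S_P(C_0)$. Algorithm DLE. It maintains a set $S_e$ of eligible points, initially the area of $S_P(C_0)$; points are only removed. Each particle $p$ has $status\in\{undecided,leader,follower\}$ (initially $undecided$) and $eligible[0..5]$ (initially $eligible[i]$ true iff the point via port $i$ is not in the outer face of $S_P(C_0)$), referring to points adjacent to $p$'s head. On activation: (a) if $p$ is expanded, it contracts into its head; (b) else if $p$ and all its neighbors have status $\ne undecided$, $p$ terminates (enters a final state); (c) else if $p.status=undecided$ ($p$ contracted at $v$): if by its $eligible$ array no neighbor of $v$ is in $S_e$, it sets $status:=leader$; else if $v$ is SCE w.r.t. $S_e$, then $v$ is removed from $S_e$ and each neighboring particle whose head is adjacent to $v$ sets its $eligible$ entry for $v$ to false; then, if $v$ has an adjacent point $u\in S_e$ not occupied by any particle, $p$ sets its $eligible$ entries to true except the one for the port from $u$ back to $v$ (set false) and expands into $u$; otherwise $p$ sets $status:=follower$. Otherwise $p$ does nothing. *)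

(* Defs.v *)
From Stdlib Require Import ZArith Arith.
Open Scope Z_scope.

(* Points in axial coordinates: (x,y) stands for x*e1 + y*e2 with
   e1 = (1,0), e2 = (1/2, sqrt 3 / 2).  Unit-distance neighbours are the
   six points below; directions 0..5 are listed in clockwise order. *)
Definition point : Type := (Z * Z)%type.

Definition nb (v : point) (d : nat) : point :=
  let '(x, y) := v in
  match d with
  | 0%nat => (x + 1, y)
  | 1%nat => (x + 1, y - 1)
  | 2%nat => (x, y - 1)
  | 3%nat => (x - 1, y)
  | 4%nat => (x - 1, y + 1)
  | _ => (x, y + 1)
  end.

Definition adj (u v : point) : Prop := exists d, (d < 6)%nat /\ v = nb u d.

Inductive walk (A : point -> Prop) : point -> point -> nat -> Prop :=
| walk0 : forall u, A u -> walk A u u 0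
| walkS : forall u v w k, A u -> adj u v -> walk A v w k -> walk A u w (S k).

Definition connected_set (A : point -> Prop) : Prop :=
  forall u v, A u -> A v -> exists k, walk A u v k.

(* grid point x not in S lies in the outer (unbounded) face of S:
   it can reach arbitrarily far points by grid paths avoiding S *)
Definition outer (S : point -> Prop) (x : point) : Prop :=
  ~ S x /\
  forall B : Z, exists y k, B < Z.abs (fst y) + Z.abs (snd y) /\
                            walk (fun z => ~ S z) x y k.

(* area of S = S together with its hole points = all points not in the
   outer face *)
Definition area (S : point -> Prop) (x : point) : Prop := ~ outer S x.

Definition diam_le (S A : point -> Prop) (D : nat) : Prop :=
  forall u v, S u -> S v -> exists k, (k <= D)%nat /\ walk A u v k.

Definition outer_boundary (S : point -> Prop) (v : point) : Prop :=
  S v /\ exists d, (d < 6)%nat /\ outer S (nb v d).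

(* local boundary of v: maximal clockwise cyclic interval of l consecutive
   edges, starting at direction s, all leading to points not in S *)
Definition local_boundary (S : point -> Prop) (v : point) (s l : nat) : Prop :=
  (s < 6)%nat /\ (1 <= l <= 6)%nat /\
  (forall i, (i < l)%nat -> ~ S (nb v ((s + i) mod 6))) /\
  ((l < 6)%nat -> S (nb v ((s + 5) mod 6)) /\ S (nb v ((s + l) mod 6))).

Definition boundary_count (l : nat) : Z := Z.of_nat l - 2.

Definition redundant (S : point -> Prop) (v : point) : Prop :=
  S v /\ connected_set (fun x => adj v x /\ S x).

Definition erodable (S : point -> Prop) (v : point) : Prop :=
  redundant S v /\ outer_boundary S v.

Definition SCE (S : point -> Prop) (v : point) : Prop :=
  erodable S v /\
  exists s l, local_boundary S v s l /\ boundary_count l > 0.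

Inductive status := Undecided | Leader | Follower.

(* eligible entries are indexed by the (global) direction 0..5 of the
   corresponding edge at the particle's head *)
Record PState := mkPS {
  head : point;
  tail : option point;          (* None = contracted *)
  stat : status;
  elig : nat -> Prop;
  final : bool }.

Record Config := mkConfig {
  st : nat -> PState;          (* particles are 0 .. n-1 *)
  Se : point -> Prop }.

Definition occupies (s : PState) (x : point) : Prop :=
  head s = x \/ tail s = Some x.

Definition occupied (n : nat) (C : Config) (x : point) : Prop :=
  exists q, (q < n)%nat /\ occupies (st C q) x.

Definition setp (f : nat -> PState) (p : nat) (s : PState) : nat -> PState :=
  fun q => if Nat.eq_dec q p then s else f q.

Definition clear_v (f : nat -> PState) (v : point) : nat -> PState :=
  fun q => let s := f q in
    mkPS (head s) (tail s) (stat s)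
         (fun d => elig s d /\ nb (head s) d <> v) (final s).

Definition all_ineligible (s : PState) : Prop :=
  forall d, (d < 6)%nat -> ~ elig s d.

(* One atomic activation of particle p (p < n) transforming C into C'.
   The target u of an expansion is any admissible point (the algorithm's
   choice is left unconstrained). *)
Inductive step (n : nat) (C : Config) (p : nat) : Config -> Prop :=
| st_final :
    final (st C p) = true -> step n C p C
| st_contract : forall w,
    final (st C p) = false -> tail (st C p) = Some w ->
    let s := st C p in
    step n C p (mkConfig (setp (st C) p
                  (mkPS (head s) None (stat s) (elig s) false)) (Se C))
| st_terminate :
    final (st C p) = false -> tail (st C p) = None ->
    stat (st C p) <> Undecided ->
    (forall q, (q < n)%nat -> q <> p ->
       (exists x, adj (head (st C p)) x /\ occupies (st C q) x) ->
       stat (st C q) <> Undecided) ->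
    let s := st C p in
    step n C p (mkConfig (setp (st C) p
                  (mkPS (head s) None (stat s) (elig s) true)) (Se C))
| st_wait_decided :
    final (st C p) = false -> tail (st C p) = None ->
    stat (st C p) <> Undecided ->
    ~ (forall q, (q < n)%nat -> q <> p ->
       (exists x, adj (head (st C p)) x /\ occupies (st C q) x) ->
       stat (st C q) <> Undecided) ->
    step n C p C
| st_leader :
    final (st C p) = false -> tail (st C p) = None ->
    stat (st C p) = Undecided -> all_ineligible (st C p) ->
    let s := st C p in
    step n C p (mkConfig (setp (st C) p
                  (mkPS (head s) None Leader (elig s) false)) (Se C))
| st_expand : forall u,
    final (st C p) = false -> tail (st C p) = None ->
    stat (st C p) = Undecided -> ~ all_ineligible (st C p) ->
    SCE (Se C) (head (st C p)) ->
    adj (head (st C p)) u -> Se C u -> ~ occupied n C u ->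
    let v := head (st C p) in
    step n C p (mkConfig (setp (clear_v (st C) v) p
                  (mkPS u (Some v) Undecided (fun d => nb u d <> v) false))
                  (fun x => Se C x /\ x <> v))
| st_follower :
    final (st C p) = false -> tail (st C p) = None ->
    stat (st C p) = Undecided -> ~ all_ineligible (st C p) ->
    SCE (Se C) (head (st C p)) ->
    (forall u, adj (head (st C p)) u -> Se C u -> occupied n C u) ->
    let v := head (st C p) in
    let f := clear_v (st C) v in
    step n C p (mkConfig (setp f p
                  (mkPS v None Follower (elig (f p)) false))
                  (fun x => Se C x /\ x <> v))
| st_wait_undecided :
    final (st C p) = false -> tail (st C p) = None ->
    stat (st C p) = Undecided -> ~ all_ineligible (st C p) ->
    ~ SCE (Se C) (head (st C p)) ->
    step n C p C.

Definition SP (n : nat) (pos : nat -> point) (x : point) : Prop :=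
  exists p, (p < n)%nat /\ pos p = x.

Definition initial (n : nat) (pos : nat -> point) (C0 : Config) : Prop :=
  (1 <= n)%nat /\
  (forall p q, (p < n)%nat -> (q < n)%nat -> pos p = pos q -> p = q) /\
  connected_set (SP n pos) /\
  (forall x, Se C0 x <-> area (SP n pos) x) /\
  (forall p, (p < n)%nat ->
     head (st C0 p) = pos p /\ tail (st C0 p) = None /\
     stat (st C0 p) = Undecided /\ final (st C0 p) = false /\
     (forall d, (d < 6)%nat ->
        (elig (st C0 p) d <-> ~ outer (SP n pos) (nb (pos p) d)))).

Definition execution (n : nat) (C : nat -> Config) (a : nat -> nat) : Prop :=
  forall t, (a t < n)%nat /\ step n (C t) (a t) (C (S t)).

Definition fair (n : nat) (a : nat -> nat) : Prop :=
  forall p t, (p < n)%nat -> exists s, (t <= s)%nat /\ a s = p.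

Definition covers (n : nat) (a : nat -> nat) (t t' : nat) : Prop :=
  forall p, (p < n)%nat -> exists s, (t <= s < t')%nat /\ a s = p.

(* round_end n a k t : the first k rounds consist of activations 0 .. t-1
   (rounds are consecutive minimal fragments covering all particles) *)
Inductive round_end (n : nat) (a : nat -> nat) : nat -> nat -> Prop :=
| re0 : round_end n a 0 0
| reS : forall k t t',
    round_end n a k t -> covers n a t t' ->
    (forall t'', (t'' < t')%nat -> ~ covers n a t t'') ->
    round_end n a (S k) t'.

Definition all_final (n : nat) (C : Config) : Prop :=
  forall p, (p < n)%nat -> final (st C p) = true.

(* Main.v *)
(** Each removal of an SCE point from the eligible set [Se] is an isometric embedding: the
    neighbours of such a point in [Se] form an arc of at most three points.  Since a connected hole-free set always
    has an SCE point, [Se] collapses to a point [o], and rebuilding it from [o] shows that the distance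
    [d] to [o] has the local structure of a nonpositively curved complex, simultaneously at all
    times: adjacent points of equal distance share a parent, and the parents of a point are adjacent.
    Hence a farthest point is SCE unless it has two parents and siblings on both sides, so each level
    is eroded from the ends of its runs of two-parent points.  If [m] bounds the length of the run
    starting at [x] then [m] can be taken at most [d x], and the children of [x] have runs of length at
    most [m + 1]; thus [x] has disappeared after about [2 (R - d x) + m] double rounds, where
    [R <= 3 D] is the eccentricity of [o]. *)

From Stdlib Require Import ZArith Arith Lia List Classical.
Require Import Defs.
Import ListNotations.

(** * Geometry of the triangular lattice *)

(** The order of removals is up to the scheduler, so neither [o] nor [d] can be fixed in advance.
    The labelling is therefore built backwards from a finite time horizon: an SCE point is found
    repeatedly until one point is left, and the removed points are put back one by one without
    changing the labels already given. The existence of an SCE point is a discrete Jordan-type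
    statement, obtained from winding numbers: a horizontal run that does not disconnect the set has
    neighbours on one side only, and these are contiguous. The value [2 (R - d x) + m] drops
    strictly towards everything that can block [x]: a child gains one level and at most one unit of
    run (-2 + 1), the next sibling on the run has the same level and a run shorter by one. Each
    value costs two rounds because the particle on [x] may have just expanded and must contract
    first. With [m <= d x <= R] the value is at most [2 R]. The radius is [3 D] and not [D], since
    [D] only measures distances between occupied points while [o] and [x] may be hole points. *)

Definition vadd (p q : point) : point := (fst p + fst q, snd p + snd q).
Definition vsub (p q : point) : point := (fst p - fst q, snd p - snd q).
Infix "+v" := vadd (at level 50, left associativity).
Infix "-v" := vsub (at level 50, left associativity).

Definition unit (u : point) : Prop :=
  -1 <= fst u <= 1 /\ -1 <= snd u <= 1 /\ -1 <= fst u + snd u <= 1 /\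
  (fst u <> 0 \/ snd u <> 0).

(* Two unit vectors at an angle of 60 degrees. *)
Definition frame (u c : point) : Prop := unit u /\ unit c /\ unit (c -v u).

Lemma point_ext (p q : point) : fst p = fst q -> snd p = snd q -> p = q.
Proof. destruct p, q; simpl; intros; subst; reflexivity. Qed.

Lemma point_eq_dec (p q : point) : {p = q} + {p <> q}.
Proof. repeat decide equality. Qed.

Ltac pt := apply point_ext; simpl in *; lia.

Lemma adj_unit (p q : point) : adj p q <-> unit (q -v p).
Proof.
  destruct p as [x y], q as [x' y']; unfold unit, adj; simpl; split.
  - intros (d & Hd & E).
    do 6 (destruct d as [|d]; [simpl in E; injection E as -> ->; lia|]); lia.
  - intros H.
    assert (K : (x' = x + 1 /\ y' = y) \/ (x' = x + 1 /\ y' = y - 1) \/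
      (x' = x /\ y' = y - 1) \/ (x' = x - 1 /\ y' = y) \/
      (x' = x - 1 /\ y' = y + 1) \/ (x' = x /\ y' = y + 1)) by lia.
    destruct K as [[-> ->]|[[-> ->]|[[-> ->]|[[-> ->]|[[-> ->]|[-> ->]]]]]];
      [exists 0%nat|exists 1%nat|exists 2%nat|exists 3%nat|exists 4%nat|exists 5%nat];
      (split; [lia|reflexivity]).
Qed.

Lemma adj_sym (p q : point) : adj p q -> adj q p.
Proof. rewrite !adj_unit. unfold unit; simpl. lia. Qed.

Lemma adj_irrefl (p : point) : ~ adj p p.
Proof. rewrite adj_unit. unfold unit; simpl. lia. Qed.

Lemma adj_vadd (p u : point) : adj p (p +v u) <-> unit u.
Proof. rewrite adj_unit. unfold unit; simpl. lia. Qed.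

Lemma nb_adj (p : point) (d : nat) : (d < 6)%nat -> adj p (nb p d).
Proof. intros H. exists d. auto. Qed.

(** There are six choices of [u] and two orientations. Identities between frame vectors thus become
    twelve numerical checks, run by [frames]. *)
Lemma frame_cases (u c : point) : frame u c ->
  In (u, c) [((1,0),(1,-1)); ((1,-1),(0,-1)); ((0,-1),(-1,0)); ((-1,0),(-1,1));
             ((-1,1),(0,1)); ((0,1),(1,0));
             ((1,-1),(1,0)); ((0,-1),(1,-1)); ((-1,0),(0,-1)); ((-1,1),(-1,0));
             ((0,1),(-1,1)); ((1,0),(0,1))].
Proof.
  destruct u as [a b], c as [a' b']; unfold frame, unit; simpl. intros H.
  assert (Ha : a = -1 \/ a = 0 \/ a = 1) by lia.
  assert (Hb : b = -1 \/ b = 0 \/ b = 1) by lia.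
  assert (Ha' : a' = -1 \/ a' = 0 \/ a' = 1) by lia.
  assert (Hb' : b' = -1 \/ b' = 0 \/ b' = 1) by lia.
  destruct Ha as [->|[->| ->]], Hb as [->|[->| ->]]; try (exfalso; lia);
  destruct Ha' as [->|[->| ->]], Hb' as [->|[->| ->]]; try (exfalso; lia); tauto.
Qed.

Ltac frames H :=
  let K := fresh in
  pose proof (frame_cases _ _ H) as K; clear H; simpl in K;
  repeat (destruct K as [K|K]; [injection K as <- <-|]); [..|contradiction K].

Ltac geo := rewrite ?adj_unit in *; unfold unit in *; simpl in *; try lia.

Lemma frame_swap (u c : point) : frame u c -> frame (c -v u) c.
Proof. unfold frame, unit; simpl. lia. Qed.

Lemma frame_sym (u c : point) : frame u c -> frame c u.
Proof. unfold frame, unit; simpl. lia. Qed.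

Lemma frame_of_adj (x y z : point) :
  adj x y -> adj x z -> adj y z -> frame (y -v x) (z -v x).
Proof. rewrite !adj_unit. unfold frame, unit; simpl. lia. Qed.

Lemma six_neighbours (u c x z : point) : frame u c -> adj x z ->
  z = x +v u \/ z = x +v c \/ z = x +v (c -v u) \/
  z = x -v u \/ z = x -v c \/ z = x -v (c -v u).
Proof.
  intros F. destruct x as [x y], z as [x' y'].
  assert (E : forall a b a' b' : Z, (a, b) = (a', b') <-> a = a' /\ b = b')
    by (split; [intros K; injection K; auto | intros [-> ->]; auto]).
  frames F; unfold vadd, vsub; simpl; rewrite !E; geo.
Qed.

Lemma common_neighbours (u t x z : point) : frame u t ->
  adj x z -> adj (x +v t) z -> z = x +v u \/ z = x +v (t -v u).
Proof.
  intros F. destruct x as [x y], z as [x' y'].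
  assert (E : forall a b a' b' : Z, (a, b) = (a', b') <-> a = a' /\ b = b')
    by (split; [intros K; injection K; auto | intros [-> ->]; auto]).
  frames F; unfold vadd, vsub; simpl; rewrite !E; geo.
Qed.

(** * SCE points *)

(** The directions [u], [c], [c - u] are consecutive with [c] in the middle, in either orientation.
    The last clause excludes the one disconnected pattern, both ends without the middle. *)
Definition arc (E : point -> Prop) (v u c : point) : Prop :=
  frame u c /\
  (forall z, adj v z -> E z -> z = v +v u \/ z = v +v c \/ z = v +v (c -v u)) /\
  (E (v +v u) -> E (v +v (c -v u)) -> E (v +v c)).

Definition hole_free (E : point -> Prop) : Prop := forall x, ~ E x -> outer E x.

Definition dir (d : nat) : point := nb (0, 0) d.

Lemma nb_dir (v : point) (d : nat) : nb v d = v +v dir d.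
Proof.
  destruct v as [x y].
  do 5 (destruct d as [|d]; [apply point_ext; simpl; lia|]).
  apply point_ext; simpl; lia.
Qed.

Lemma walk_start A u v k : walk A u v k -> A u.
Proof. destruct 1; auto. Qed.

Lemma walk_end A u v k : walk A u v k -> A v.
Proof. induction 1; auto. Qed.

(** A positive boundary count gives three consecutive free directions, so all neighbours lie in the
    three opposite ones; redundancy supplies the middle. *)
Lemma SCE_arc (E : point -> Prop) (v : point) :
  SCE E v -> E v /\ (exists z, adj v z /\ ~ E z) /\ exists u c, arc E v u c.
Proof.
  intros [[[Ev Con] [_ (d0 & Hd0 & O)]] (s & l & (Hs & Hl & Hno & _) & Hc)].
  split; [exact Ev|]. split.
  { exists (nb v d0). split; [apply nb_adj; auto|apply O]. }
  unfold boundary_count in Hc.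
  assert (N0 := Hno 0%nat ltac:(lia)). assert (N1 := Hno 1%nat ltac:(lia)).
  assert (N2 := Hno 2%nat ltac:(lia)). clear Hno Hl Hc O.
  (* Directions [s], [s + 1], [s + 2] are free, hence the arc is [s + 3], [s + 4], [s + 5]. *)
  exists (dir ((s + 3) mod 6)), (dir ((s + 4) mod 6)).
  rewrite !nb_dir in *.
  assert (F : frame (dir ((s + 3) mod 6)) (dir ((s + 4) mod 6))).
  { do 6 (destruct s as [|s]; [unfold frame, unit; simpl; lia|]). lia. }
  assert (R : dir ((s + 0) mod 6) = (0,0) -v dir ((s + 3) mod 6) /\
    dir ((s + 1) mod 6) = (0,0) -v dir ((s + 4) mod 6) /\
    dir ((s + 2) mod 6) = dir ((s + 3) mod 6) -v dir ((s + 4) mod 6)).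
  { clear -Hs. do 6 (destruct s as [|s]; [repeat split|]). lia. }
  destruct R as (R0 & R1 & R2).
  rewrite R0 in N0. rewrite R1 in N1. rewrite R2 in N2.
  revert F N0 N1 N2. generalize (dir ((s + 3) mod 6)) (dir ((s + 4) mod 6)).
  clear - Con. intros u c F N0 N1 N2. split; [exact F|].
  assert (Nb : forall z, adj v z -> E z ->
     z = v +v u \/ z = v +v c \/ z = v +v (c -v u)).
  { intros z Az Ez.
    destruct (six_neighbours u c v z F Az) as [->|[->|[->|[->|[->| ->]]]]]; auto; exfalso.
    - apply N0. replace (v +v ((0,0) -v u)) with (v -v u) by pt. exact Ez.
    - apply N1. replace (v +v ((0,0) -v c)) with (v -v c) by pt. exact Ez.
    - apply N2. replace (v +v (u -v c)) with (v -v (c -v u)) by pt. exact Ez. }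
  split; [exact Nb|]. intros Eu Ew.
  assert (Au : adj v (v +v u)) by (apply adj_vadd, F).
  assert (Aw : adj v (v +v (c -v u))) by (apply adj_vadd, F).
  destruct (Con (v +v u) (v +v (c -v u)) (conj Au Eu) (conj Aw Ew)) as [k W].
  clear - W F Nb.
  remember (v +v u) as p eqn:Ep. remember (v +v (c -v u)) as q eqn:Eq.
  (* Inside the neighbourhood of [v], the first edge of a walk leaving one end of the arc can only
     lead to its middle. *)
  destruct W as [p|p q' q k Hp A W].
  - exfalso. clear Nb. rewrite Ep in Eq. frames F; apply (f_equal fst) in Eq as E1;
      apply (f_equal snd) in Eq as E2; simpl in *; lia.
  - apply walk_start in W as [Av Eq']. destruct (Nb q' Av Eq') as [->|[->| ->]].
    + exfalso. subst p. eapply adj_irrefl; eauto.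
    + exact Eq'.
    + exfalso. subst. clear - F A. frames F; geo.
Qed.

(** The point opposite the middle of the arc is free, and hole-freeness puts it in the outer
    face. *)
Lemma arc_SCE (E : point -> Prop) (v u c : point) :
  hole_free E -> E v -> arc E v u c -> SCE E v.
Proof.
  intros HF Ev (F & Nb & Mid).
  assert (NEc : ~ E (v -v c)).
  { intros K. destruct (Nb (v -v c)) as [Q|[Q|Q]]; auto.
    - apply adj_unit. destruct F as (_ & F & _). revert F. unfold unit; simpl; lia.
    - apply (f_equal fst) in Q as E1. apply (f_equal snd) in Q as E2.
      clear -E1 E2 F. frames F; simpl in *; lia.
    - apply (f_equal fst) in Q as E1. apply (f_equal snd) in Q as E2.
      clear -E1 E2 F. frames F; simpl in *; lia.
    - apply (f_equal fst) in Q as E1. apply (f_equal snd) in Q as E2.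
      clear -E1 E2 F. frames F; simpl in *; lia. }
  split; [split; [split; [exact Ev|]|split; [exact Ev|]]|].
  - assert (Fu : adj (v +v u) (v +v c)).
    { clear -F. frames F; geo. }
    assert (Fw : adj (v +v (c -v u)) (v +v c)).
    { clear -F. frames F; geo. }
    intros x y [Ax Ex] [Ay Ey].
    destruct (point_eq_dec x y) as [->|Nxy].
    { exists 0%nat. constructor. auto. }
    destruct (classic (adj x y)) as [A|NA].
    { exists 1%nat. econstructor; eauto. constructor; auto. }
    assert (Ec : E (v +v c) /\ adj x (v +v c) /\ adj (v +v c) y).
    { destruct (Nb x Ax Ex) as [->|[->| ->]], (Nb y Ay Ey) as [->|[->| ->]];
        try congruence; try (exfalso; apply NA; auto using adj_sym; fail);
        auto using adj_sym. }
    destruct Ec as (Ec & A1 & A2).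
    assert (Av : adj v (v +v c)) by (apply adj_vadd, F).
    exists 2%nat. apply walkS with (v +v c); auto.
    apply walkS with y; auto. constructor. auto.
  - assert (A : adj v (v -v c)).
    { apply adj_unit. destruct F as (_ & F & _). revert F. unfold unit; simpl; lia. }
    destruct A as (d & Hd & Ed). exists d. split; [exact Hd|].
    rewrite <- Ed. apply HF, NEc.
  (* [k] is the first of three free directions; the local boundary is then read off from the seven
     admissible patterns on the remaining three. *)
  - assert (Hk : exists k, (k < 6)%nat /\
      ~ E (nb v (k mod 6)) /\ ~ E (nb v ((k + 1) mod 6)) /\ ~ E (nb v ((k + 2) mod 6)) /\
      (E (nb v ((k + 3) mod 6)) -> E (nb v ((k + 5) mod 6)) -> E (nb v ((k + 4) mod 6)))).
    { assert (G : forall a b, In (a, b) [(0,3);(1,4);(2,5);(3,0);(4,1);(5,2)]%nat ->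
        dir a = (0,0) -v dir b /\ (a < 6)%nat).
      { simpl. intros a b K.
        repeat destruct K as [K|K]; [injection K as <- <-; split; [reflexivity|lia]..|contradiction]. }
      assert (Far : forall z, adj v z -> z <> v +v u -> z <> v +v c -> z <> v +v (c -v u) -> ~ E z).
      { intros z A K1 K2 K3 Ez. destruct (Nb z A Ez) as [|[|]]; auto. }
      assert (Ne : forall p q : point, (fst p <> fst q \/ snd p <> snd q) -> v +v p <> v +v q).
      { intros p q K Q. apply (f_equal fst) in Q as E1. apply (f_equal snd) in Q as E2.
        simpl in *. lia. }
      clear Ev NEc HF G Nb.
      frames F;
        [exists 3%nat|exists 4%nat|exists 5%nat|exists 0%nat|exists 1%nat|exists 2%nat|exists 2%nat|exists 3%nat|exists 4%nat|exists 5%nat|exists 0%nat|exists 1%nat];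
        (split; [lia|]); rewrite !nb_dir;
        cbn [Nat.modulo Nat.divmod Nat.add Nat.sub fst snd dir nb Z.add] in *;
        (split; [|split; [|split]]);
        try (apply Far; [apply adj_vadd; unfold unit; simpl; lia|apply Ne; simpl; lia..]);
        simpl; intros K1 K2; auto. }
    clear - Hk. destruct Hk as (k & Hk & N0 & N1 & N2 & Mid).
    destruct (classic (E (nb v ((k + 3) mod 6)))) as [E3|E3];
    destruct (classic (E (nb v ((k + 4) mod 6)))) as [E4|E4];
    destruct (classic (E (nb v ((k + 5) mod 6)))) as [E5|E5];
    try (exfalso; auto; fail);
    [exists k, 3%nat | exists ((k+5) mod 6)%nat, 4%nat | exists ((k+4) mod 6)%nat, 5%nat
    | exists k, 4%nat | exists ((k+5) mod 6)%nat, 5%nat | exists k, 5%nat | exists 0%nat, 6%nat];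
    (split; [|unfold boundary_count; lia]);
    clear Mid;
    do 6 (destruct k as [|k];
      [cbn [Nat.modulo Nat.divmod Nat.add Nat.sub fst snd] in *;
       (split; [lia|split; [lia|split; [|intros; try lia; split; assumption]]]);
       intros i Hi;
       do 6 (destruct i as [|i]; [try lia; simpl; assumption|]); lia|]); lia.
Qed.

(** * Walks, minimal witnesses and bounded sets *)

Lemma walk_trans A u v w k l : walk A u v k -> walk A v w l -> walk A u w (k + l).
Proof. induction 1; simpl; eauto using walk. Qed.

Lemma walk_snoc A u v w k : walk A u v k -> adj v w -> A w -> walk A u w (k + 1).
Proof.
  intros W Ad Aw. apply walk_trans with v; auto.
  apply walkS with w; auto. eapply walk_end; eauto. constructor; auto.
Qed.

Lemma walk_rev A u v k : walk A u v k -> walk A v u k.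
Proof.
  induction 1 as [|u v w k Au Ad W IH]; [constructor; auto|].
  replace (Datatypes.S k) with (k + 1)%nat by lia.
  eapply walk_snoc; eauto using adj_sym.
Qed.

Lemma walk_mono (A B : point -> Prop) u v k :
  (forall x, A x -> B x) -> walk A u v k -> walk B u v k.
Proof. induction 2; eauto using walk. Qed.

Lemma least (P : nat -> Prop) :
  (exists n, P n) -> exists n, P n /\ forall m, (m < n)%nat -> ~ P m.
Proof.
  intros [n Hn]. induction n as [n IH] using (well_founded_induction lt_wf).
  destruct (classic (exists m, (m < n)%nat /\ P m)) as [(m & Hm & Pm)|No].
  - eauto.
  - exists n. split; [exact Hn|]. intros m Hm Pm. eauto.
Qed.

Definition bounded (K : Z) (E : point -> Prop) : Prop :=
  forall p, E p -> - K <= fst p <= K /\ - K <= snd p <= K.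

Lemma bounded_list (K : Z) (E : point -> Prop) :
  bounded K E -> exists L, forall x, E x -> In x L.
Proof.
  intros HB.
  set (r := map (fun i => Z.of_nat i - K) (seq 0 (Z.to_nat (2 * K + 1)))).
  exists (list_prod r r). intros [x y] Hx. apply HB in Hx. simpl in Hx.
  apply in_prod; apply in_map_iff;
    [exists (Z.to_nat (x + K))|exists (Z.to_nat (y + K))];
    (split; [lia|apply in_seq; lia]).
Qed.

Lemma bounded_sup (K : Z) (E : point -> Prop) (P : point -> nat -> Prop) :
  bounded K E -> (forall p, E p -> exists k, P p k) ->
  exists M, forall p, E p -> exists k, (k <= M)%nat /\ P p k.
Proof.
  intros HB HP. destruct (bounded_list K E HB) as [L HL].
  assert (G : exists M, forall p, In p L -> E p -> exists k, (k <= M)%nat /\ P p k).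
  { clear HL. induction L as [|q L [M IH]].
    - exists 0%nat. intros p [].
    - destruct (classic (E q)) as [Eq|Nq].
      + destruct (HP q Eq) as [k Hk]. exists (Nat.max k M).
        intros p [<-|Hp] Ep; [exists k; split; [lia|auto]|].
        destruct (IH p Hp Ep) as (k' & L1 & L2). exists k'; split; [lia|auto].
      + exists M. intros p [<-|Hp] Ep; [contradiction|auto]. }
  destruct G as [M G]. exists M. auto.
Qed.

(** * Winding numbers *)

Fixpoint path (E : point -> Prop) (u : point) (l : list point) : Prop :=
  match l with
  | [] => True
  | v :: l' => adj u v /\ E v /\ path E v l'
  end.

Fixpoint path_end (u : point) (l : list point) : point :=
  match l with [] => u | v :: l' => path_end v l' end.

Fixpoint flux (f : point -> point -> Z) (u : point) (l : list point) : Z :=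
  match l with [] => 0 | v :: l' => f u v + flux f v l' end.

Lemma path_app E u l l' :
  path E u l -> path E (path_end u l) l' -> path E u (l ++ l').
Proof. revert u; induction l; simpl; intuition. Qed.

Lemma path_end_app u l l' : path_end u (l ++ l') = path_end (path_end u l) l'.
Proof. revert u; induction l; simpl; auto. Qed.

Lemma flux_app f u l l' : flux f u (l ++ l') = flux f u l + flux f (path_end u l) l'.
Proof. revert u; induction l as [|v l IH]; simpl; intros; auto. rewrite IH. lia. Qed.

Lemma path_mono (A B : point -> Prop) u l :
  (forall x, A x -> B x) -> path A u l -> path B u l.
Proof. intros H. revert u; induction l; simpl; intuition. Qed.

Lemma walk_path E u v k : walk E u v k -> exists l, path E u l /\ path_end u l = v.
Proof.
  induction 1 as [|u v w k Eu Ad W (l & P & En)].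
  - exists []. simpl; auto.
  - exists (v :: l). simpl. repeat split; auto. eapply walk_start; eauto.
Qed.

(** Discrete Stokes: the coboundary of [chi] telescopes, so it contributes nothing along a closed
    path. *)
Lemma flux_cobound E f g chi u l :
  E u -> path E u l ->
  (forall p q, E p -> E q -> adj p q -> f p q = g p q + chi q - chi p) ->
  flux f u l = flux g u l + chi (path_end u l) - chi u.
Proof.
  intros Eu P H. revert u Eu P. induction l as [|v l IH]; simpl; intros u Eu P; [lia|].
  destruct P as (Ad & Ev & P). rewrite (IH v Ev P), (H u v Eu Ev Ad). lia.
Qed.

Lemma flux_zero E f u l :
  E u -> path E u l -> (forall p q, E p -> E q -> f p q = 0) -> flux f u l = 0.
Proof.
  intros Eu P H. revert u Eu P. induction l as [|v l IH]; simpl; intros u Eu P; auto.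
  destruct P as (Ad & Ev & P). rewrite (IH v Ev P), (H u v Eu Ev). lia.
Qed.

Lemma flux_sub f g u l :
  flux (fun p q => f p q - g p q) u l = flux f u l - flux g u l.
Proof. revert u; induction l as [|v l IH]; simpl; intros; auto. rewrite IH. lia. Qed.

(* [above g] counts the signed crossings of the horizontal ray issued from [g] to the right and
   pushed slightly upwards; [below g] is the same with the ray pushed slightly downwards. *)
Definition above (g p q : point) : Z :=
  Z.b2z ((snd p =? snd g) && (snd q =? snd g + 1) && (fst g <? fst p)) -
  Z.b2z ((snd q =? snd g) && (snd p =? snd g + 1) && (fst g <? fst q)).

Definition below (g p q : point) : Z :=
  Z.b2z ((snd p =? snd g - 1) && (snd q =? snd g) && (fst g <? fst q)) -
  Z.b2z ((snd q =? snd g - 1) && (snd p =? snd g) && (fst g <? fst p)).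

Ltac bcase :=
  cbn [andb Z.b2z];
  match goal with
  | |- context [?a =? ?b] => destruct (Z.eqb_spec a b); try (exfalso; lia); bcase
  | |- context [?a <? ?b] => destruct (Z.ltb_spec a b); try (exfalso; lia); bcase
  | _ => lia
  end.

Lemma above_up g p q : snd q = snd p + 1 ->
  above g p q = Z.b2z ((snd p =? snd g) && (fst g <? fst p)).
Proof. unfold above. intros ->. bcase. Qed.

Lemma below_up g p q : snd q = snd p + 1 ->
  below g p q = Z.b2z ((snd q =? snd g) && (fst g <? fst q)).
Proof. unfold below. intros ->. bcase. Qed.

Lemma above_flat g p q : snd q = snd p -> above g p q = 0.
Proof. unfold above. intros ->. bcase. Qed.

Lemma below_flat g p q : snd q = snd p -> below g p q = 0.
Proof. unfold below. intros ->. bcase. Qed.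

Lemma above_anti g p q : above g q p = - above g p q.
Proof. unfold above. lia. Qed.

Lemma below_anti g p q : below g q p = - below g p q.
Proof. unfold below. lia. Qed.

(** Antisymmetry leaves only flat and upward edges; in axial coordinates an upward edge changes the
    first coordinate by 0 or -1. *)
Lemma cobound_steps (E : point -> Prop) (f g : point -> point -> Z) (chi : point -> Z) :
  (forall p q, f q p = - f p q) -> (forall p q, g q p = - g p q) ->
  (forall p q, E p -> E q -> -1 <= fst q - fst p <= 1 -> snd q = snd p ->
    f p q = g p q + chi q - chi p) ->
  (forall p q, E p -> E q -> -1 <= fst q - fst p <= 0 -> snd q = snd p + 1 ->
    f p q = g p q + chi q - chi p) ->
  forall p q, E p -> E q -> adj p q -> f p q = g p q + chi q - chi p.
Proof.
  intros Af Ag Fl Up p q Ep Eq A.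
  apply adj_unit in A. unfold unit in A. cbn [fst snd vsub] in A.
  assert (C : snd q = snd p + 1 \/ snd p = snd q + 1 \/ snd p = snd q) by lia.
  destruct C as [C|[C|C]].
  - apply Up; auto. lia.
  - rewrite Af, Ag, Up; auto; lia.
  - apply Fl; auto. lia.
Qed.

Lemma point_neq (p q : point) : p <> q -> fst p <> fst q \/ snd p <> snd q.
Proof.
  intros H. destruct (Z.eq_dec (fst p) (fst q)), (Z.eq_dec (snd p) (snd q)); auto.
  exfalso. apply H, point_ext; auto.
Qed.

Lemma not_in_neq (E : point -> Prop) p g :
  E p -> ~ E g -> fst p <> fst g \/ snd p <> snd g.
Proof. intros Ep Ng. apply point_neq. intros ->. contradiction. Qed.

Section Winding.
Variables (E : point -> Prop) (K : Z) (u : point) (l : list point).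
Hypotheses (HB : bounded K E) (Eu : E u) (P : path E u l) (Cl : path_end u l = u).

(** Pushing the ray across its own row changes the crossing count by the coboundary of the indicator
    of the ray, because [g] itself is not on the path. *)
Lemma flux_below g : ~ E g -> flux (below g) u l = flux (above g) u l.
Proof.
  intros Ng.
  rewrite (flux_cobound E (below g) (above g)
    (fun p => Z.b2z ((snd p =? snd g) && (fst g <? fst p))) u l); auto.
  - rewrite Cl. lia.
  - apply cobound_steps; auto using above_anti, below_anti.
    + intros p q Ep Eq Hf Hs. rewrite above_flat, below_flat, Hs by auto.
      destruct (not_in_neq E p g Ep Ng), (not_in_neq E q g Eq Ng); bcase.
    + intros p q Ep Eq Hf Hs. rewrite above_up, below_up by auto. lia.
Qed.

(** The winding number is constant on each component of the complement. In a common row the two rays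
    differ only at [g] or [h]; for [h] one row higher, the ray above [g] and the ray below [h] cross
    the same edges of [E]. *)
Lemma flux_above_adj g h : ~ E g -> ~ E h -> adj g h ->
  flux (above g) u l = flux (above h) u l.
Proof.
  assert (G : forall f f',
    (forall p q, E p -> E q -> adj p q -> f p q = f' p q + 0 - 0) ->
    flux f u l = flux f' u l).
  { intros f f' H. rewrite (flux_cobound E f f' (fun _ => 0) u l); auto. lia. }
  assert (Up : forall g h, ~ E g -> ~ E h -> adj g h -> snd h = snd g + 1 ->
    flux (above g) u l = flux (above h) u l).
  { intros g' h' Ng Nh A Hs. rewrite <- (flux_below h') by auto. apply G.
    apply (cobound_steps E _ _ (fun _ => 0)); auto using above_anti, below_anti.
    - intros p q Ep Eq _ Hs'. rewrite above_flat, below_flat by auto. lia.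
    - intros p q Ep Eq Hf Hs'. rewrite above_up, below_up by auto.
      apply adj_unit in A. unfold unit in A; cbn [fst snd vsub] in A.
      destruct (not_in_neq E p g' Ep Ng), (not_in_neq E q h' Eq Nh); bcase. }
  intros Ng Nh A. pose proof A as A'.
  apply adj_unit in A'. unfold unit in A'; cbn [fst snd vsub] in A'.
  assert (C : snd h = snd g + 1 \/ snd g = snd h + 1 \/ snd g = snd h) by lia.
  destruct C as [C|[C|C]].
  - auto.
  - symmetry. apply Up; auto using adj_sym.
  - apply G. apply (cobound_steps E _ _ (fun _ => 0)); auto using above_anti.
    + intros p q Ep Eq _ Hs'. rewrite !above_flat by auto. lia.
    + intros p q Ep Eq Hf Hs'. rewrite !above_up, C by auto.
      destruct (not_in_neq E p g Ep Ng), (not_in_neq E p h Ep Nh); bcase.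
Qed.

(** The winding number is carried along a walk that avoids [E] to a point outside the bounding
    box. *)
Lemma flux_above_outer g : outer E g -> flux (above g) u l = 0.
Proof.
  intros [Ng O]. destruct (O (2 * K + 2)) as (y & k & Far & W).
  assert (Eq : flux (above g) u l = flux (above y) u l).
  { clear -W HB Eu P Cl. induction W as [|a b c k Na Ad W IH]; auto.
    rewrite <- IH. apply flux_above_adj; auto. apply walk_start in W; auto. }
  rewrite Eq.
  (* From the left of the box the ray cuts [E] completely, so its crossing count is the coboundary
     of the indicator of the upper part; elsewhere the ray misses [E]. *)
  destruct (Z_lt_ge_dec (fst y) (- K)) as [Left|Right].
  - rewrite (flux_cobound E (above y) (fun _ _ => 0) (fun p => Z.b2z (snd y <? snd p)) u l); auto.
    + rewrite Cl, (flux_zero E); auto; lia.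
    + apply (cobound_steps E (above y) (fun _ _ => 0)); auto using above_anti.
      * intros p q Ep Eq' _ Hs. rewrite above_flat, Hs by auto. lia.
      * intros p q Ep Eq' _ Hs. rewrite above_up by auto. apply HB in Ep, Eq'. bcase.
  - apply flux_zero with E; auto. intros p q Ep Eq'. apply HB in Ep, Eq'.
    unfold above; bcase.
Qed.
End Winding.

(** * Existence of SCE points *)

(** The counter records only edges that change row; moves within a row are free. *)
Inductive reach (E : point -> Prop) (b : point) : nat -> point -> Prop :=
| reach_base : E b -> reach E b 0 b
| reach_flat k p q : reach E b k p -> adj p q -> snd q = snd p -> E q -> reach E b k q
| reach_jump k p q : reach E b k p -> adj p q -> snd q <> snd p -> E q ->
    reach E b (Datatypes.S k) q.

Lemma walk_reach E b p n : walk E b p n -> exists k, reach E b k p.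
Proof.
  intros W.
  assert (G : forall u v m, walk E u v m -> forall k, reach E b k u -> exists k', reach E b k' v).
  { induction 1 as [|u v w m Eu Ad W' IH]; eauto. intros k R.
    assert (Ev : E v) by (eapply walk_start; eauto).
    destruct (Z.eq_dec (snd v) (snd u)); eapply IH; eauto using reach. }
  eapply G; eauto. constructor. eapply walk_start; eauto.
Qed.

Lemma row_walk (E : point -> Prop) (y : Z) (n : nat) : forall i,
  (forall j, i <= j <= i + Z.of_nat n -> E (j, y)) ->
  walk E (i, y) (i + Z.of_nat n, y) n.
Proof.
  induction n as [|n IH]; intros i H.
  - replace (i + Z.of_nat 0) with i by lia. constructor. apply H. lia.
  - apply walkS with (i + 1, y).
    + apply H. lia.
    + apply adj_unit. unfold unit; simpl; lia.
    + replace (i + Z.of_nat (Datatypes.S n)) with ((i + 1) + Z.of_nat n) by lia.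
      apply IH. intros j Hj. apply H. lia.
Qed.

Lemma row_connected (E : point -> Prop) (y a b i j : Z) :
  (forall k, a <= k <= b -> E (k, y)) -> a <= i <= b -> a <= j <= b ->
  exists n, walk E (i, y) (j, y) n.
Proof.
  intros H Hi Hj. destruct (Z_le_gt_dec i j).
  - exists (Z.to_nat (j - i)). replace j with (i + Z.of_nat (Z.to_nat (j - i))) at 1 by lia.
    apply row_walk. intros k Hk. apply H. lia.
  - exists (Z.to_nat (i - j)). apply walk_rev.
    replace i with (j + Z.of_nat (Z.to_nat (i - j))) at 1 by lia.
    apply row_walk. intros k Hk. apply H. lia.
Qed.

Lemma row_end (K : Z) (E : point -> Prop) (x y s : Z) : bounded K E -> E (x, y) ->
  s = 1 \/ s = -1 ->
  exists n : nat, (forall j, (j <= n)%nat -> E (x + s * Z.of_nat j, y)) /\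
    ~ E (x + s * Z.of_nat n + s, y).
Proof.
  intros HB Ex Hs.
  destruct (least (fun n => ~ E (x + s * Z.of_nat n + s, y))) as (n & Hn & Hmin).
  { exists (Z.to_nat (2 * K + 1)). intros Q. apply HB in Q. apply HB in Ex.
    cbn [fst snd] in *. destruct Hs as [-> | ->]; lia. }
  exists n. split; [|exact Hn]. intros j Hj.
  destruct j as [|j].
  - replace (x + s * Z.of_nat 0) with x by lia. exact Ex.
  - specialize (Hmin j ltac:(lia)). apply NNPP in Hmin.
    replace (x + s * Z.of_nat (Datatypes.S j)) with (x + s * Z.of_nat j + s) by lia.
    exact Hmin.
Qed.

Definition row (a b y : Z) (p : point) : Prop := snd p = y /\ a <= fst p <= b.

(* Take a run at maximal vertical distance from [b0]: optimal walks to its neighbours avoid it. *)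
Lemma extremal_run (K : Z) (E : point -> Prop) (b0 : point) :
  bounded K E -> connected_set E -> E b0 ->
  exists a b y, a <= b /\ (forall p, row a b y p -> E p) /\
    ~ E (a - 1, y) /\ ~ E (b + 1, y) /\
    forall z1 z2, E z1 -> E z2 -> ~ row a b y z1 -> ~ row a b y z2 ->
      exists k, walk (fun z => E z /\ ~ row a b y z) z1 z2 k.
Proof.
  intros HB HC E0.
  assert (HR : forall p, E p -> exists k, reach E b0 k p).
  { intros p Ep. destruct (HC b0 p E0 Ep) as [n W]. eapply walk_reach; eauto. }
  destruct (least (fun M => forall p, E p -> exists k, (k <= M)%nat /\ reach E b0 k p))
    as (M & HM & Hmin).
  { apply bounded_sup with K; auto. }
  assert (Hx : exists x, E x /\ forall k, (k < M)%nat -> ~ reach E b0 k x).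
  { destruct M as [|M].
    - exists b0. split; auto. lia.
    - specialize (Hmin M ltac:(lia)). apply not_all_ex_not in Hmin as [x Hx].
      apply imply_to_and in Hx as [Ex Hx]. exists x. split; auto.
      intros k Hk R. apply Hx. exists k. split; [lia|auto]. }
  destruct Hx as ((x & y) & Ex & Hx).
  destruct (row_end K E x y 1 HB Ex ltac:(auto)) as (r & Hr & Nr).
  destruct (row_end K E x y (-1) HB Ex ltac:(auto)) as (s & Hs & Ns).
  set (a := x - Z.of_nat s). set (b := x + Z.of_nat r).
  assert (Row : forall p, row a b y p -> E p).
  { intros [i j] [Hj Hi]. cbn [fst snd] in *. subst j. destruct (Z_le_gt_dec x i).
    - specialize (Hr (Z.to_nat (i - x)) ltac:(lia)).
      replace (x + 1 * Z.of_nat (Z.to_nat (i - x))) with i in Hr by lia. exact Hr.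
    - specialize (Hs (Z.to_nat (x - i)) ltac:(lia)).
      replace (x + -1 * Z.of_nat (Z.to_nat (x - i))) with i in Hs by lia. exact Hs. }
  replace (x + 1 * Z.of_nat r + 1) with (b + 1) in Nr by lia.
  replace (x + -1 * Z.of_nat s + -1) with (a - 1) in Ns by lia.
  exists a, b, y. split; [lia|]. split; [exact Row|]. split; [exact Ns|]. split; [exact Nr|].
  assert (Far : forall p, row a b y p -> forall k, (k < M)%nat -> ~ reach E b0 k p).
  { intros [i j] [Hj Hi] k Hk R. cbn [fst snd] in *. subst j. apply (Hx k Hk).
    assert (W : exists n, walk (row a b y) (i, y) (x, y) n).
    { apply row_connected with a b; [|lia|lia]. intros k' Hk'. split; simpl; [auto|lia]. }
    destruct W as [n W]. remember (x, y) as q. clear Heqq.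
    assert (G : forall u v m, walk (row a b y) u v m -> reach E b0 k u -> reach E b0 k v).
    { induction 1 as [|u v w m Ru Ad W' IH]; auto. intros R'. apply IH.
      apply walk_start in W'. apply reach_flat with u; auto.
      destruct Ru, W'. congruence. }
    eapply G; eauto. }
  set (E' := fun z => E z /\ ~ row a b y z).
  (* A walk with at most [M] row changes cannot leave the run once it is there: horizontal exits are
     not in [E], and another row change would mean that the run was reached with fewer than [M]. *)
  assert (Avoid : forall k p, reach E b0 k p -> (k <= M)%nat ->
     row a b y p \/ exists n, walk E' b0 p n).
  { induction 1 as [_|k p q R IH Ad Hs' Eq|k p q R IH Ad Hs' Eq]; intros Hk.
    - destruct (classic (row a b y b0)); auto. right. exists 0%nat. constructor. split; auto.
    - destruct (classic (row a b y q)) as [|Nq]; auto. right.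
      destruct (IH Hk) as [Rp|[n W]].
      + exfalso. apply adj_unit in Ad. unfold unit in Ad; cbn [fst snd vsub] in Ad.
        destruct p as [p1 p2], q as [q1 q2]. unfold row in *. cbn [fst snd] in *.
        assert (C : q2 = y /\ (q1 = a - 1 \/ q1 = b + 1)) by lia.
        destruct C as [-> [-> | ->]]; auto.
      + eexists. eapply walk_snoc; eauto. split; auto.
    - destruct (classic (row a b y q)) as [|Nq]; auto. right.
      destruct (IH ltac:(lia)) as [Rp|[n W]].
      + exfalso. apply (Far p Rp k ltac:(lia)). exact R.
      + eexists. eapply walk_snoc; eauto. split; auto. }
  intros z1 z2 E1 E2 N1 N2.
  destruct (HM z1 E1) as (k1 & L1 & R1). destruct (HM z2 E2) as (k2 & L2 & R2).
  destruct (Avoid k1 z1 R1 L1) as [|[n1 W1]]; [contradiction|].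
  destruct (Avoid k2 z2 R2 L2) as [|[n2 W2]]; [contradiction|].
  eexists. eapply walk_trans; [apply walk_rev; exact W1|exact W2].
Qed.

(** The loop goes from [x1] to [z1], outside the run to [z2], then to [x2] and back along the run.
    If [f] vanishes on flat edges and on edges off the run, only the two connecting edges count. *)
Lemma run_loop (E : point -> Prop) (a b y : Z) (z1 z2 x1 x2 : point) (k : nat) :
  (forall p, row a b y p -> E p) -> E z1 -> E z2 ->
  walk (fun z => E z /\ ~ row a b y z) z1 z2 k ->
  row a b y x1 -> row a b y x2 -> adj x1 z1 -> adj x2 z2 ->
  exists l, path E x1 l /\ path_end x1 l = x1 /\
    forall f, (forall p q, f q p = - f p q) ->
     (forall p q, snd q = snd p -> f p q = 0) ->
     (forall p q, E p -> E q -> ~ row a b y p -> ~ row a b y q ->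
        snd q = snd p + 1 -> -1 <= fst q - fst p <= 0 -> f p q = 0) ->
     flux f x1 l = f x1 z1 + f z2 x2.
Proof.
  intros Row E1 E2 W R1 R2 A1 A2.
  assert (Wr : exists n, walk (row a b y) x2 x1 n).
  { destruct R1 as [H1 H1'], R2 as [H2 H2'], x1 as [i1 j1], x2 as [i2 j2]. cbn [fst snd] in *. subst.
    apply row_connected with a b; auto. intros k' Hk'. split; auto. }
  destruct Wr as [n Wr].
  pose proof (walk_start _ _ _ _ W) as S1.
  destruct (walk_path _ _ _ _ W) as (l1 & P1 & En1).
  destruct (walk_path _ _ _ _ Wr) as (l2 & P2 & En2).
  exists (z1 :: l1 ++ x2 :: l2).
  assert (En : path_end x1 (z1 :: l1 ++ x2 :: l2) = x1).
  { simpl. rewrite path_end_app, En1. simpl. exact En2. }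
  split; [|split; [exact En|]].
  - simpl. split; [auto|]. split; [auto|]. apply path_app.
    + eapply path_mono; [|exact P1]. intros z [? ?]; auto.
    + rewrite En1. simpl. split; [auto using adj_sym|]. split; [apply Row; auto|].
      eapply path_mono; [|exact P2]. auto.
  - intros f An Fl Zr. simpl. rewrite flux_app, En1. simpl.
    rewrite (flux_zero (row a b y) f x2 l2); auto.
    2:{ intros p q [Hp _] [Hq _]. apply Fl. congruence. }
    rewrite (flux_cobound (fun z => E z /\ ~ row a b y z) f (fun _ _ => 0) (fun _ => 0) z1 l1); auto.
    + rewrite (flux_zero (fun z => E z /\ ~ row a b y z) (fun _ _ => 0) z1 l1); auto. lia.
    + apply (cobound_steps _ f (fun _ _ => 0) (fun _ => 0)); auto.
      intros p q [Ep Np] [Eq Nq] Hf Hs. rewrite Zr by auto. lia.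
Qed.

(** A non-separating run has its vertical neighbours on one side, and they form an interval. One of
    the two ends of such a run is then an SCE point. *)
Lemma exists_SCE (K : Z) (E : point -> Prop) (b0 : point) :
  bounded K E -> connected_set E -> hole_free E -> E b0 -> exists v, SCE E v.
Proof.
  intros HB HC HF E0.
  destruct (extremal_run K E b0 HB HC E0) as (a & b & y & Hab & Row & Na & Nb & Sep).
  assert (Loop : forall z1 z2 x1 x2 f, E z1 -> E z2 -> row a b y x1 -> row a b y x2 ->
     ~ row a b y z1 -> ~ row a b y z2 -> adj x1 z1 -> adj x2 z2 ->
     (forall p q, f q p = - f p q) ->
     (forall p q, snd q = snd p -> f p q = 0) ->
     (forall p q, E p -> E q -> ~ row a b y p -> ~ row a b y q ->
        snd q = snd p + 1 -> -1 <= fst q - fst p <= 0 -> f p q = 0) ->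
     (forall l, path E x1 l -> path_end x1 l = x1 -> flux f x1 l = 0) ->
     f x1 z1 + f z2 x2 = 0).
  { intros z1 z2 x1 x2 f E1 E2 R1 R2 N1 N2 A1 A2 An Fl Z Cl.
    destruct (Sep z1 z2 E1 E2 N1 N2) as [k W].
    destruct (run_loop E a b y z1 z2 x1 x2 k Row E1 E2 W R1 R2 A1 A2) as (l & P & En & Hl).
    rewrite <- (Hl f An Fl Z). auto. }
  assert (Adj : forall i j i' j', adj (i, j) (i', j') <->
    -1 <= i' - i <= 1 /\ -1 <= j' - j <= 1 /\ -1 <= (i' - i) + (j' - j) <= 1 /\
    (i' - i <> 0 \/ j' - j <> 0)).
  { intros. rewrite adj_unit. unfold unit. simpl. tauto. }
  assert (AdjU : forall i j i', adj (i, j) (i', j + 1) -> -1 <= i' - i <= 0).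
  { intros i j i' A. apply Adj in A. lia. }
  assert (AdjD : forall i j i', adj (i, j) (i', j - 1) -> 0 <= i' - i <= 1).
  { intros i j i' A. apply Adj in A. lia. }
  set (g := (b + 1, y)) in *. set (g' := (a - 1, y)) in *.
  assert (WA : forall h l x1, E x1 -> ~ E h -> path E x1 l -> path_end x1 l = x1 ->
     flux (above h) x1 l = 0).
  { intros. apply flux_above_outer with E K; auto. }
  assert (WB : forall h l x1, E x1 -> ~ E h -> path E x1 l -> path_end x1 l = x1 ->
     flux (below h) x1 l = 0).
  { intros. rewrite (flux_below E) by auto. auto. }
  (* [f] counts upward edges that start between the two free points bounding the run. A loop leaving
     the run upwards and returning from below has flux 1, although both winding numbers are 0. *)
  assert (OneSide : forall x1 x2 i1 i2, row a b y x1 -> row a b y x2 ->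
    E (i1, y + 1) -> E (i2, y - 1) -> adj x1 (i1, y + 1) -> adj x2 (i2, y - 1) -> False).
  { intros [x1 y1] [x2 y2] i1 i2 R1 R2 E1 E2 A1 A2.
    set (f := (fun p q => above g' p q - above g p q)).
    assert (L : f (x1, y1) (i1, y + 1) + f (i2, y - 1) (x2, y2) = 0).
    { apply Loop; auto; unfold f.
      - unfold row; simpl; lia.
      - unfold row; simpl; lia.
      - intros. rewrite (above_anti g'), (above_anti g). lia.
      - intros. rewrite !above_flat; auto.
      - intros p q Ep Eq Np Nq Hs Hf. rewrite !above_up by auto.
        destruct (not_in_neq E p g Ep Nb); unfold row, g, g' in *; cbn [fst snd] in *; bcase.
      - intros l P En. rewrite flux_sub, !WA; auto. }
    revert L. unfold f. destruct R1, R2. cbn [fst snd] in *. subst y1 y2.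
    apply AdjU in A1; apply AdjD in A2.
    rewrite !above_up by (cbn [snd]; lia).
    unfold g, g'. cbn [fst snd]. bcase. }
  (* If [h] were a gap, a loop leaving the run on its left and returning on its right would wind
     once around [h]; subtracting [above g] cancels the edges beyond the right end of the run. *)
  assert (Up : forall x1 x2 i1 i2 h, row a b y x1 -> row a b y x2 ->
    E (i1, y + 1) -> E (i2, y + 1) -> adj x1 (i1, y + 1) -> adj x2 (i2, y + 1) ->
    i1 < h < i2 -> E (h, y + 1)).
  { intros [x1 y1] [x2 y2] i1 i2 h R1 R2 E1 E2 A1 A2 Hh. apply NNPP. intros Nh.
    set (f := (fun p q => below (h, y + 1) p q - above g p q)).
    assert (L : f (x1, y1) (i1, y + 1) + f (i2, y + 1) (x2, y2) = 0).
    { apply Loop; auto; unfold f.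
      - unfold row; simpl; lia.
      - unfold row; simpl; lia.
      - intros. rewrite (above_anti g), below_anti. lia.
      - intros. rewrite above_flat, below_flat; auto.
      - intros p q Ep Eq Np Nq Hs Hf. rewrite above_up, below_up by auto.
        destruct R1, R2. cbn [fst snd] in *. subst y1 y2. apply AdjU in A1, A2.
        destruct (not_in_neq E p g Ep Nb); unfold row, g, g' in *; cbn [fst snd] in *; bcase.
      - intros l P En. rewrite flux_sub, WA, WB; auto. }
    revert L. unfold f. destruct R1, R2. cbn [fst snd] in *. subst y1 y2. apply AdjU in A1, A2.
    rewrite (below_anti _ (x2, y)), (above_anti _ (x2, y)).
    rewrite !above_up, !below_up by auto. unfold g; cbn [fst snd]. bcase. }
  assert (Down : forall x1 x2 i1 i2 h, row a b y x1 -> row a b y x2 ->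
    E (i1, y - 1) -> E (i2, y - 1) -> adj x1 (i1, y - 1) -> adj x2 (i2, y - 1) ->
    i1 < h < i2 -> E (h, y - 1)).
  { intros [x1 y1] [x2 y2] i1 i2 h R1 R2 E1 E2 A1 A2 Hh. apply NNPP. intros Nh.
    set (f := (fun p q => above (h, y - 1) p q - below g p q)).
    assert (L : f (x1, y1) (i1, y - 1) + f (i2, y - 1) (x2, y2) = 0).
    { apply Loop; auto; unfold f.
      - unfold row; simpl; lia.
      - unfold row; simpl; lia.
      - intros. rewrite (below_anti g), above_anti. lia.
      - intros. rewrite above_flat, below_flat; auto.
      - intros p q Ep Eq Np Nq Hs Hf. rewrite above_up, below_up by auto.
        destruct R1, R2. cbn [fst snd] in *. subst y1 y2. apply AdjD in A1, A2.
        destruct (not_in_neq E q g Eq Nb); unfold row, g, g' in *; cbn [fst snd] in *; bcase.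
      - intros l P En. rewrite flux_sub, WA, WB; auto. }
    revert L. unfold f. destruct R1, R2. cbn [fst snd] in *. subst y1 y2. apply AdjD in A1, A2.
    rewrite (below_anti _ (i1, y - 1)), (above_anti _ (i1, y - 1)).
    rewrite !above_up, !below_up by (cbn [snd]; lia).
    unfold g; cbn [fst snd]. bcase. }
  clear Loop WA WB Sep.
  assert (RI : forall i, a <= i <= b -> row a b y (i, y)) by (intros; split; simpl; auto).
  assert (Nbr : forall i z, a <= i <= b -> adj (i, y) z -> E z ->
    z = (i + 1, y) \/ z = (i - 1, y) \/ (z = (i, y + 1) \/ z = (i - 1, y + 1)) \/
    (z = (i, y - 1) \/ z = (i + 1, y - 1))).
  { intros i [z1 z2] Hi A Ez. apply Adj in A.
    assert (C : z2 = y \/ z2 = y + 1 \/ z2 = y - 1) by lia.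
    destruct C as [-> |[-> | ->]].
    - assert (C : z1 = i + 1 \/ z1 = i - 1) by lia. destruct C as [-> | ->]; auto.
    - assert (C : z1 = i \/ z1 = i - 1) by lia. destruct C as [-> | ->]; auto.
    - assert (C : z1 = i \/ z1 = i + 1) by lia. destruct C as [-> | ->]; auto. }
  destruct (classic (exists i1 i2, a <= i1 <= b /\ E (i2, y - 1) /\ adj (i1, y) (i2, y - 1)))
    as [(k1 & k2 & Hk & Ek & Ak)|NoDown].
  - assert (NoUp : forall i1 i2, a <= i1 <= b -> adj (i1, y) (i2, y + 1) -> ~ E (i2, y + 1)).
    { intros i1 i2 H1 A1 E1. apply (OneSide (i1, y) (k1, y) i2 k2); auto. }
    clear k1 k2 Hk Ek Ak Up OneSide.
    (* The right end can fail only if its diagonal neighbour is present without the arc's middle.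
       The interval property then clears the point [(a, y - 1)], and the left end is SCE. *)
    destruct (classic (E (b + 1, y - 1) /\ ~ E (b, y - 1))) as [[E1 N1]|C].
    + exists (a, y). apply (arc_SCE E _ (1, 0) (1, -1)); auto. { apply Row, RI. lia. }
      assert (N2 : ~ E (a, y - 1)).
      { intros E2. destruct (Z.eq_dec a b) as [<-|Nab]; [auto|].
        apply N1. apply (Down (a, y) (b, y) a (b + 1)); auto; try (apply RI; lia); try lia;
          apply Adj; lia. }
      split; [unfold frame, unit; simpl; lia|]. split.
      * intros z A Ez. destruct (Nbr a z ltac:(lia) A Ez) as [-> |[-> |[[-> | ->]|[-> | ->]]]].
        -- left. pt.
        -- contradiction.
        -- exfalso. eapply NoUp; [|exact A|exact Ez]; lia.
        -- exfalso. eapply NoUp; [|exact A|exact Ez]; lia.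
        -- contradiction.
        -- right; left. pt.
      * intros _ E2. exfalso. apply N2. replace (a, y - 1) with ((a, y) +v ((1, -1) -v (1, 0))) by pt.
        exact E2.
    + exists (b, y). apply (arc_SCE E _ (1, -1) (0, -1)); auto. { apply Row, RI. lia. }
      split; [unfold frame, unit; simpl; lia|]. split.
      * intros z A Ez. destruct (Nbr b z ltac:(lia) A Ez) as [-> |[-> |[[-> | ->]|[-> | ->]]]].
        -- contradiction.
        -- right; right. pt.
        -- exfalso. eapply NoUp; [|exact A|exact Ez]; lia.
        -- exfalso. eapply NoUp; [|exact A|exact Ez]; lia.
        -- right; left. pt.
        -- left. pt.
      * intros E1 _. replace ((b, y) +v (0, -1)) with (b, y - 1) by pt.
        apply NNPP. intros N1. apply C. split; [|exact N1].
        replace (b + 1, y - 1) with ((b, y) +v (1, -1)) by pt. exact E1.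
  - assert (ND : forall i1 i2, a <= i1 <= b -> adj (i1, y) (i2, y - 1) -> ~ E (i2, y - 1)).
    { intros i1 i2 H1 A1 E1. apply NoDown. eauto. }
    clear NoDown Down OneSide.
    destruct (classic (E (a - 1, y + 1) /\ ~ E (a, y + 1))) as [[E1 N1]|C].
    + exists (b, y). apply (arc_SCE E _ (-1, 0) (-1, 1)); auto. { apply Row, RI. lia. }
      assert (N2 : ~ E (b, y + 1)).
      { intros E2. destruct (Z.eq_dec a b) as [->|Nab]; [auto|].
        apply N1. apply (Up (a, y) (b, y) (a - 1) b); auto; try (apply RI; lia); try lia;
          apply Adj; lia. }
      split; [unfold frame, unit; simpl; lia|]. split.
      * intros z A Ez. destruct (Nbr b z ltac:(lia) A Ez) as [-> |[-> |[[-> | ->]|[-> | ->]]]].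
        -- contradiction.
        -- left. pt.
        -- contradiction.
        -- right; left. pt.
        -- exfalso. eapply ND; [|exact A|exact Ez]; lia.
        -- exfalso. eapply ND; [|exact A|exact Ez]; lia.
      * intros _ E2. exfalso. apply N2.
        replace (b, y + 1) with ((b, y) +v ((-1, 1) -v (-1, 0))) by pt. exact E2.
    + exists (a, y). apply (arc_SCE E _ (-1, 1) (0, 1)); auto. { apply Row, RI. lia. }
      split; [unfold frame, unit; simpl; lia|]. split.
      * intros z A Ez. destruct (Nbr a z ltac:(lia) A Ez) as [-> |[-> |[[-> | ->]|[-> | ->]]]].
        -- right; right. pt.
        -- contradiction.
        -- right; left. pt.
        -- left. pt.
        -- exfalso. eapply ND; [|exact A|exact Ez]; lia.
        -- exfalso. eapply ND; [|exact A|exact Ez]; lia.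
      * intros E1 _. replace ((a, y) +v (0, 1)) with (a, y + 1) by pt.
        apply NNPP. intros N1. apply C. split; [|exact N1].
        replace (a - 1, y + 1) with ((a, y) +v (-1, 1)) by pt. exact E1.
Qed.

(** * Levels of a collapsible shape *)

(** [lipschitz] and [parent] force [d] to be the distance to [o] inside [E]. The axioms are local,
    so adding one point requires checks only around that point. *)
Record metric (E : point -> Prop) (o : point) (d : point -> nat) : Prop := {
  origin_in : E o;
  origin_zero : d o = 0%nat;
  lipschitz : forall x y, E x -> E y -> adj x y -> (d y <= d x + 1)%nat;
  parent : forall x, E x -> x <> o -> exists y, E y /\ adj x y /\ d x = (d y + 1)%nat;
  triangle : forall x y, E x -> E y -> adj x y -> d x = d y ->
    exists z, E z /\ adj x z /\ adj y z /\ d x = (d z + 1)%nat;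
  parents_adj : forall x y z, E x -> E y -> E z -> adj x y -> adj x z ->
    d x = (d y + 1)%nat -> d x = (d z + 1)%nat -> y <> z -> adj y z }.

Lemma common_neighbours' (x y z u t : point) : frame u t -> y = x +v t ->
  adj x z -> adj y z -> z = x +v u \/ z = x +v (t -v u).
Proof. intros F ->. apply common_neighbours. exact F. Qed.

Ltac fr F := clear -F; frames F; unfold frame; geo.

Section Extension.
Variables (E : point -> Prop) (o : point) (d : point -> nat) (v u c U M W : point).
Hypotheses (G : metric E o d) (F : frame u c)
  (EU : U = v +v u) (EM : M = v +v c) (EW : W = v +v (c -v u))
  (HU : E U) (HM : E M) (HW : E W) (Hv : ~ E v).

Let AM : adj M U.
Proof. subst. fr F. Qed.
Let AW : adj M W.
Proof. subst. fr F. Qed.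

(** The six neighbours of [M] are, in cyclic order, [v], [U], [p], [r], [q], [W]. Since [v] is
    absent, the common parents of [M] with [U] and with [W] are [p] and [q]; two parents of [M] must
    be adjacent, but [r] separates them. *)
Lemma flat_arc_absurd : d U = d M -> d M = d W -> False.
Proof.
  intros H1 H2.
  destruct (triangle _ _ _ G M U HM HU AM ltac:(lia)) as (p & Ep & A1 & A2 & D1).
  destruct (triangle _ _ _ G M W HM HW AW ltac:(lia)) as (q & Eq & A3 & A4 & D2).
  assert (F1 : frame ((0,0) -v c) (u -v c)) by (fr F).
  destruct (common_neighbours' M U p _ _ F1 ltac:(subst; pt) A1 A2) as [-> | ->].
  { apply Hv. replace v with (M +v ((0, 0) -v c)) by (subst; pt). exact Ep. }
  assert (F2 : frame ((0,0) -v c) ((0,0) -v u)) by (fr F).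
  destruct (common_neighbours' M W q _ _ F2 ltac:(subst; pt) A3 A4) as [-> | ->].
  { apply Hv. replace v with (M +v ((0, 0) -v c)) by (subst; pt). exact Eq. }
  assert (A : adj (M +v (u -v c -v ((0, 0) -v c))) (M +v ((0, 0) -v u -v ((0, 0) -v c)))).
  { apply (parents_adj _ _ _ G M); auto.
    intros Q. apply (f_equal fst) in Q as Q1. apply (f_equal snd) in Q as Q2.
    clear -F Q1 Q2. frames F; simpl in *; lia. }
  clear -A F. frames F; geo.
Qed.

(** In the same hexagon [U] and [q] would both be parents of [M], yet they are opposite. *)
Lemma step_arc_absurd : d M = d W -> d M = (d U + 1)%nat -> False.
Proof.
  intros H1 H2.
  destruct (triangle _ _ _ G M W HM HW AW ltac:(lia)) as (q & Eq & A3 & A4 & D2).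
  assert (F2 : frame ((0,0) -v c) ((0,0) -v u)) by (fr F).
  destruct (common_neighbours' M W q _ _ F2 ltac:(subst; pt) A3 A4) as [-> | ->].
  { apply Hv. replace v with (M +v ((0, 0) -v c)) by (subst; pt). exact Eq. }
  assert (A : adj U (M +v ((0, 0) -v u -v ((0, 0) -v c)))).
  { apply (parents_adj _ _ _ G M); auto.
    intros Q. apply (f_equal fst) in Q as Q1. apply (f_equal snd) in Q as Q2.
    subst. clear -F Q1 Q2. frames F; simpl in *; lia. }
  subst. clear -A F. frames F; geo.
Qed.

(** A second parent of [W] must be [q], at the level of [M]; the common parent of [M] and [q] is
    then [r], which is not adjacent to the parent [U]. This lets [v] become a parent of [W] without
    violating [parents_adj]. *)
Lemma steep_arc_parent w : d M = (d U + 1)%nat -> d W = (d M + 1)%nat ->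
  E w -> adj W w -> d W = (d w + 1)%nat -> w = M.
Proof.
  intros H1 H2 Ew Aw Hw. apply NNPP. intros Nw.
  assert (A : adj M w).
  { apply (parents_adj _ _ _ G W); auto using adj_sym. }
  assert (F2 : frame ((0,0) -v c) ((0,0) -v u)) by (fr F).
  destruct (common_neighbours' M W w _ _ F2 ltac:(subst; pt) A Aw) as [-> | ->].
  { apply Hv. replace v with (M +v ((0, 0) -v c)) by (subst; pt). exact Ew. }
  destruct (triangle _ _ _ G M _ HM Ew A ltac:(lia)) as (q & Eq & A3 & A4 & D2).
  assert (F3 : frame ((0,0) -v u) ((0, 0) -v u -v ((0, 0) -v c))) by (fr F).
  destruct (common_neighbours _ _ M q F3 A3 A4) as [-> | ->].
  { replace (M +v ((0, 0) -v u)) with W in D2 by (subst; pt). lia. }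
  match goal with H : E (M +v ?x) |- _ => assert (A5 : adj U (M +v x)) end.
  { apply (parents_adj _ _ _ G M); auto; try lia.
    intros Q. apply (f_equal fst) in Q as Q1. apply (f_equal snd) in Q as Q2.
    subst. clear -F Q1 Q2. frames F; simpl in *; lia. }
  subst. clear -A5 F. frames F; geo.
Qed.
End Extension.

(** The returned point gets the label one above its lowest neighbour. That the old labels survive is
    the isometric embedding. *)
Lemma metric_extend (E : point -> Prop) (o : point) (d : point -> nat) (v u c : point) :
  metric (fun x => E x /\ x <> v) o d -> E v -> arc E v u c ->
  (exists z, adj v z /\ E z) ->
  exists d', (forall x, x <> v -> d' x = d x) /\ metric E o d'.
Proof.
  intros G Ev (F & Nb & Mid) (z0 & A0 & Ez0).
  assert (NE : forall z, adj v z -> z <> v) by (intros z A ->; eapply adj_irrefl; eauto).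
  destruct (least (fun n => exists z, adj v z /\ E z /\ d z = n)) as (n & (m & Am & Em & Dm) & Hmin).
  { eauto. }
  assert (Min : forall z, adj v z -> E z -> (n <= d z)%nat).
  { intros z A Ez. destruct (le_lt_dec n (d z)) as [|L]; auto.
    exfalso. apply (Hmin _ L). eauto. }
  clear Hmin z0 A0 Ez0.
  set (E' := fun x => E x /\ x <> v) in *.
  assert (In : forall z, adj v z -> E z -> E' z) by (intros z A Ez; split; auto).
  assert (Nv : ~ E' v) by (intros [_ Q]; auto).
  (* These four facts are what [lipschitz], [triangle] and [parents_adj] require around [v], the
     last two covering [v] as a child and [v] as a parent. *)
  assert (Main :
    (forall z, adj v z -> E z -> (d z <= n + 2)%nat) /\
    (forall z, adj v z -> E z -> d z = (n + 1)%nat ->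
       exists w, adj v w /\ E w /\ adj z w /\ d w = n) /\
    (forall y z, adj v y -> E y -> adj v z -> E z -> d y = n -> d z = n -> y <> z -> adj y z) /\
    (forall z w, adj v z -> E z -> d z = (n + 2)%nat -> E' w -> adj z w ->
       d w = (n + 1)%nat -> adj v w)).
  { destruct (classic (E (v +v u) /\ E (v +v (c -v u)))) as [[HU HW]|Short].
    - assert (HM := Mid HU HW).
      assert (AU : adj v (v +v u)) by (apply adj_vadd, F).
      assert (AM : adj v (v +v c)) by (apply adj_vadd, F).
      assert (AW : adj v (v +v (c -v u))) by (apply adj_vadd, F).
      assert (AMU : adj (v +v c) (v +v u)) by (fr F).
      assert (AMW : adj (v +v c) (v +v (c -v u))) by (fr F).
      assert (EWU : v +v u = v +v (c -v (c -v u))) by pt.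
      pose proof (frame_swap _ _ F) as F'.
      pose proof (flat_arc_absurd _ _ _ v u c _ _ _ G F eq_refl eq_refl eq_refl
        (In _ AU HU) (In _ AM HM) (In _ AW HW) Nv) as B0.
      pose proof (step_arc_absurd _ _ _ v u c _ _ _ G F eq_refl eq_refl eq_refl
        (In _ AU HU) (In _ AM HM) (In _ AW HW) Nv) as B1.
      pose proof (step_arc_absurd _ _ _ v (c -v u) c _ _ _ G F' eq_refl eq_refl EWU
        (In _ AW HW) (In _ AM HM) (In _ AU HU) Nv) as B2.
      pose proof (steep_arc_parent _ _ _ v u c _ _ _ G F eq_refl eq_refl eq_refl
        (In _ AU HU) (In _ AM HM) (In _ AW HW) Nv) as B3.
      pose proof (steep_arc_parent _ _ _ v (c -v u) c _ _ _ G F' eq_refl eq_refl EWU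
        (In _ AW HW) (In _ AM HM) (In _ AU HU) Nv) as B4.
      assert (B5 : d (v +v c) = (d (v +v u) + 1)%nat -> d (v +v c) = (d (v +v (c -v u)) + 1)%nat -> False).
      { intros H1 H2.
        assert (A : adj (v +v u) (v +v (c -v u))).
        { apply (parents_adj _ _ _ G (v +v c)); auto.
          intros Q. apply (f_equal fst) in Q as Q1. apply (f_equal snd) in Q as Q2.
          clear -F Q1 Q2. frames F; simpl in *; lia. }
        clear -A F. frames F; geo. }
      pose proof (lipschitz _ _ _ G _ _ (In _ AU HU) (In _ AM HM) (adj_sym _ _ AMU)) as L1.
      pose proof (lipschitz _ _ _ G _ _ (In _ AM HM) (In _ AU HU) AMU) as L2.
      pose proof (lipschitz _ _ _ G _ _ (In _ AW HW) (In _ AM HM) (adj_sym _ _ AMW)) as L3.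
      pose proof (lipschitz _ _ _ G _ _ (In _ AM HM) (In _ AW HW) AMW) as L4.
      pose proof (Min _ AU HU) as M1. pose proof (Min _ AM HM) as M2. pose proof (Min _ AW HW) as M3.
      assert (Hn : n = d (v +v u) \/ n = d (v +v c) \/ n = d (v +v (c -v u))).
      { destruct (Nb m Am Em) as [Q|[Q|Q]]; rewrite <- Q; auto. }
      clear m Am Em Dm Min Mid.
      repeat split.
      + intros z A Ez. destruct (Nb z A Ez) as [-> |[-> | ->]]; lia.
      + intros z A Ez Dz. destruct (Nb z A Ez) as [-> |[-> | ->]].
        * exists (v +v c). repeat split; auto using adj_sym. lia.
        * destruct Hn as [Hn|[Hn|Hn]]; [exists (v +v u)|lia|exists (v +v (c -v u))]; auto.
        * exists (v +v c). repeat split; auto using adj_sym. lia.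
      + intros y z Ay Ey Az Ez Dy Dz Nyz.
        destruct (Nb y Ay Ey) as [-> |[-> | ->]], (Nb z Az Ez) as [-> |[-> | ->]];
          auto using adj_sym; try congruence; exfalso; lia.
      + intros z w Az Ez Dz Ew Aw Dw.
        destruct (Nb z Az Ez) as [-> |[-> | ->]]; [|exfalso; lia|].
        * rewrite (B4 w); auto; lia.
        * rewrite (B3 w); auto; lia.
    (* With an end of the arc missing, the neighbours of [v] are pairwise adjacent and their labels
       take at most two values. *)
    - assert (Clique : forall y z, adj v y -> E y -> adj v z -> E z -> y <> z -> adj y z).
      { intros y z Ay Ey Az Ez Nyz.
        destruct (Nb y Ay Ey) as [-> |[-> | ->]], (Nb z Az Ez) as [-> |[-> | ->]];
          try congruence; try (exfalso; apply Short; auto; fail); fr F. }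
      assert (L : forall z, adj v z -> E z -> (d z <= n + 1)%nat).
      { intros z A Ez. destruct (point_eq_dec m z) as [<-|N]; [lia|].
        rewrite <- Dm. apply (lipschitz _ _ _ G m z); auto. }
      repeat split.
      + intros z A Ez. specialize (L z A Ez). lia.
      + intros z A Ez Dz. exists m. repeat split; auto. apply Clique; auto. intros ->. lia.
      + auto.
      + intros z w Az Ez Dz. specialize (L z Az Ez). lia. }
  clear Mid Nb F. destruct Main as (L & Tri & Par & Par').
  set (d' := fun x => if point_eq_dec x v then (n + 1)%nat else d x).
  assert (Dv : d' v = (n + 1)%nat).
  { unfold d'. destruct (point_eq_dec v v); congruence. }
  assert (Dd : forall x, x <> v -> d' x = d x).
  { intros x Hx. unfold d'. destruct (point_eq_dec x v); congruence. }
  exists d'. split; [exact Dd|]. destruct (origin_in _ _ _ G) as [Eo No]. split.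
  - exact Eo.
  - rewrite Dd by exact No. apply (origin_zero _ _ _ G).
  - intros x y Ex Ey A. destruct (point_eq_dec x v) as [->|Nx].
    + rewrite Dv, Dd by auto. specialize (L y A Ey). lia.
    + rewrite (Dd x Nx). destruct (point_eq_dec y v) as [->|Ny].
      * rewrite Dv. specialize (Min x (adj_sym _ _ A) Ex). lia.
      * rewrite Dd by auto. apply (lipschitz _ _ _ G); auto; split; auto.
  - intros x Ex Hx. destruct (point_eq_dec x v) as [->|Nx].
    + exists m. rewrite Dv, Dd by auto. repeat split; auto; lia.
    + destruct (parent _ _ _ G x (conj Ex Nx) Hx) as (y & [Ey Ny] & A & D).
      exists y. rewrite !Dd by auto. auto.
  - assert (Tv : forall x, E x -> x <> v -> adj v x -> d x = (n + 1)%nat ->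
      exists z, E z /\ adj v z /\ adj x z /\ (n + 1)%nat = (d' z + 1)%nat).
    { intros x Ex Nx A D. destruct (Tri x A Ex D) as (w & Aw & Ew & Axw & Dw).
      exists w. rewrite Dd by auto. repeat split; auto; lia. }
    intros x y Ex Ey A. destruct (point_eq_dec x v) as [->|Nx].
    + rewrite Dv, Dd by auto. intros D. apply Tv; auto.
    + rewrite (Dd x Nx). destruct (point_eq_dec y v) as [->|Ny].
      * rewrite Dv. intros D. destruct (Tv x Ex Nx (adj_sym _ _ A) D) as (z & Ez & A1 & A2 & D1).
        exists z. repeat split; auto. lia.
      * rewrite Dd by auto. intros D.
        destruct (triangle _ _ _ G x y (conj Ex Nx) (conj Ey Ny) A D) as (z & [Ez Nz] & A1 & A2 & D1).
        exists z. rewrite Dd by auto. auto.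
  - intros x y z Ex Ey Ez A1 A2.
    destruct (point_eq_dec x v) as [->|Nx].
    { rewrite Dv, !Dd by auto. intros D1 D2 N. apply Par; auto; lia. }
    rewrite (Dd x Nx).
    destruct (point_eq_dec y v) as [->|Ny], (point_eq_dec z v) as [->|Nz];
      rewrite ?Dv, ?Dd by auto; intros D1 D2 N.
    + congruence.
    + apply (Par' x z); auto using adj_sym; try lia. split; auto.
    + apply adj_sym. apply (Par' x y); auto using adj_sym; try lia. split; auto.
    + apply (parents_adj _ _ _ G x); auto; split; auto.
Qed.

(** * Erosion of shapes and labellings valid at all times *)

Lemma outer_mono (A B : point -> Prop) x :
  (forall z, A z -> B z) -> outer B x -> outer A x.
Proof.
  intros H [N O]. split; [auto|]. intros r. destruct (O r) as (y & k & Far & W).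
  exists y, k. split; [exact Far|]. eapply walk_mono; [|exact W]. simpl; auto.
Qed.

Lemma outer_adj (A : point -> Prop) x z : adj x z -> ~ A x -> outer A z -> outer A x.
Proof.
  intros Ad Nx [Nz O]. split; [exact Nx|]. intros r. destruct (O r) as (y & k & Far & W).
  exists y, (Datatypes.S k). split; [exact Far|]. apply walkS with z; auto.
Qed.

Definition shape (K : Z) (E : point -> Prop) : Prop :=
  bounded K E /\ connected_set E /\ hole_free E.

Lemma shape_ext K (E E' : point -> Prop) :
  (forall x, E x <-> E' x) -> shape K E -> shape K E'.
Proof.
  intros H (HB & HC & HF). split; [|split].
  - intros p Ep. apply HB, H, Ep.
  - intros x y Ex Ey. destruct (HC x y) as [k W]; try (apply H; assumption).
    exists k. eapply walk_mono; [|exact W]. apply H.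
  - intros x Nx. apply outer_mono with E; [apply H|]. apply HF. rewrite H. exact Nx.
Qed.

(** Redundancy reroutes any walk through [v] inside its neighbourhood, and an outer neighbour joins
    [v] to the outer face, so no hole appears. *)
Lemma shape_remove K E v : shape K E -> SCE E v -> shape K (fun x => E x /\ x <> v).
Proof.
  intros (HB & HC & HF) [[[Ev Con] [_ (d0 & Hd0 & O)]] _]. split; [|split].
  - intros p [Ep _]. auto.
  - intros x y [Ex Nx] [Ey Ny]. destruct (HC x y Ex Ey) as [k W].
    assert (G : forall x, walk E x y k ->
      (x <> v -> exists k, walk (fun x => E x /\ x <> v) x y k) /\
      (x = v -> forall p, adj v p -> E p -> exists k, walk (fun x => E x /\ x <> v) p y k)).
    { clear x Ex Nx W. intros x W. induction W as [u Eu|u w y k Eu Ad W IH].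
      - split; [|intros ->; contradiction]. intros Nu. exists 0%nat. constructor; auto.
      - destruct (IH Ey Ny) as [I1 I2]. split.
        + intros Nu. destruct (point_eq_dec w v) as [->|Nw].
          * apply I2; auto using adj_sym.
          * destruct (I1 Nw) as [j Wj]. exists (Datatypes.S j). apply walkS with w; auto.
        + intros -> p Ap Ep. pose proof (walk_start _ _ _ _ W) as Ew.
          assert (Nw : w <> v) by (intros ->; eapply adj_irrefl; eauto).
          destruct (I1 Nw) as [j Wj].
          destruct (Con p w (conj Ap Ep) (conj Ad Ew)) as [i Wi].
          exists (i + j)%nat. apply walk_trans with w; [|exact Wj].
          eapply walk_mono; [|exact Wi]. intros z [Az Ez]. split; auto.
          intros ->. eapply adj_irrefl; eauto. }
    apply (proj1 (G x W)). exact Nx.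
  - assert (Mono : forall x, outer E x -> outer (fun x => E x /\ x <> v) x).
    { intros x. apply outer_mono. intros z []; auto. }
    intros x Nx. destruct (point_eq_dec x v) as [->|Nv].
    + apply outer_adj with (nb v d0); auto. apply nb_adj, Hd0.
    + apply Mono, HF. intros Ex. auto.
Qed.

Lemma connected_neighbour E x y : connected_set E -> E x -> E y -> y <> x ->
  exists z, adj x z /\ E z.
Proof.
  intros HC Ex Ey N. destruct (HC x y Ex Ey) as [k W]. destruct W as [|u w y k _ A W].
  - congruence.
  - exists w. split; auto. eapply walk_start; eauto.
Qed.

Lemma metric_ext E E' o d d' :
  (forall x, E x <-> E' x) -> (forall x, E x -> d' x = d x) -> metric E o d -> metric E' o d'.
Proof.
  intros H Hd [Eo Zo Li Pa Tr PA].
  split.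
  - apply H, Eo.
  - rewrite Hd; auto.
  - intros x y Ex Ey. apply H in Ex, Ey. rewrite !Hd by auto. auto.
  - intros x Ex N. apply H in Ex. destruct (Pa x Ex N) as (y & Ey & A & D).
    exists y. rewrite !Hd by auto. rewrite <- H. auto.
  - intros x y Ex Ey A. apply H in Ex, Ey. rewrite !Hd by auto. intros D.
    destruct (Tr x y Ex Ey A D) as (z & Ez & A1 & A2 & D1).
    exists z. rewrite !Hd by auto. rewrite <- H. auto.
  - intros x y z Ex Ey Ez. apply H in Ex, Ey, Ez. rewrite !Hd by auto. eauto.
Qed.

Lemma shape_metric K E b : shape K E -> E b -> exists o d, metric E o d.
Proof.
  intros HS Eb. destruct (bounded_list K E (proj1 HS)) as [L HL].
  remember (length L) as n eqn:Hn. revert E L b HS Eb HL Hn.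
  induction n as [n IH] using (well_founded_induction lt_wf). intros E L b HS Eb HL Hn.
  destruct HS as (HB & HC & HF). destruct (exists_SCE K E b HB HC HF Eb) as [v Sv].
  destruct (SCE_arc E v Sv) as (Ev & _ & u & c & Ar).
  destruct (classic (exists z, E z /\ z <> v)) as [(z & Ez & Nz)|Single].
  - destruct (IH (length (remove point_eq_dec v L))) with
      (E := fun x => E x /\ x <> v) (L := remove point_eq_dec v L) (b := z)
      as (o & d & G); auto.
    + rewrite Hn. apply remove_length_lt, HL, Ev.
    + apply shape_remove; [split; auto|exact Sv].
    + intros x [Ex Nx]. apply in_in_remove; auto.
    + destruct (metric_extend E o d v u c G Ev Ar) as (d' & _ & G').
      * apply connected_neighbour with z; auto.
      * eauto.
  - assert (U : forall x, E x -> x = v).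
    { intros x Ex. apply NNPP. intros N. eauto. }
    exists v, (fun _ => 0%nat). split; auto.
    + intros. lia.
    + intros x Ex N. exfalso. auto.
    + intros x y Ex Ey A. rewrite (U x Ex), (U y Ey) in A. exfalso. eapply adj_irrefl; eauto.
    + intros x y z Ex Ey Ez A. rewrite (U x Ex), (U y Ey) in A. exfalso. eapply adj_irrefl; eauto.
Qed.

(** Stuttering covers activations that remove nothing. The remaining neighbour keeps the set
    nonempty and provides a parent when [v] is put back. *)
Definition erosion_step (E E' : point -> Prop) : Prop :=
  (forall x, E' x <-> E x) \/
  exists v, SCE E v /\ (exists z, adj v z /\ E z) /\ forall x, E' x <-> E x /\ x <> v.

Lemma erosion_mono (E : nat -> point -> Prop) :
  (forall t, erosion_step (E t) (E (Datatypes.S t))) ->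
  forall s t x, (s <= t)%nat -> E t x -> E s x.
Proof.
  intros H s t x L. induction L as [|t L IH]; auto. intros Ex. apply IH.
  destruct (H t) as [Q|(v & _ & _ & Q)]; apply Q in Ex; tauto.
Qed.

Lemma erosion_shape K E E' : erosion_step E E' -> shape K E -> shape K E'.
Proof.
  intros [Q|(v & Sv & _ & Q)] HS.
  - apply shape_ext with E; auto. intros x. symmetry. auto.
  - apply shape_ext with (fun x => E x /\ x <> v); [intros x; symmetry; auto|].
    apply shape_remove; auto.
Qed.

(* Removing an SCE point is an isometric embedding, so one labelling serves all times up to [T]. *)
Lemma erosion_metric K T : forall (E : nat -> point -> Prop),
  (forall t, erosion_step (E t) (E (Datatypes.S t))) ->
  shape K (E 0%nat) -> (exists x, E 0%nat x) ->
  exists o d, forall t, (t <= T)%nat -> metric (E t) o d.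
Proof.
  induction T as [|T IH]; intros E H HS [x0 Ex0].
  - destruct (shape_metric K (E 0%nat) x0 HS Ex0) as (o & d & G).
    exists o, d. intros t Ht. replace t with 0%nat by lia. exact G.
  - destruct (IH (fun t => E (Datatypes.S t))) as (o & d & G).
    + intros t. apply H.
    + apply erosion_shape with (E 0%nat); auto.
    + destruct (H 0%nat) as [Q|(v & _ & (z & A & Ez) & Q)].
      * exists x0. apply Q, Ex0.
      * exists z. apply Q. split; auto. intros ->. eapply adj_irrefl; eauto.
    + destruct (H 0%nat) as [Q|(v & Sv & Hz & Q)].
      * exists o, d. intros [|t] Ht; [|apply G; lia].
        apply metric_ext with (E 1%nat) d; auto. apply G; lia.
      * destruct (SCE_arc _ _ Sv) as (Ev & _ & u & c & Ar).
        destruct (metric_extend (E 0%nat) o d v u c) as (d' & Hd & G'); auto.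
        { apply metric_ext with (E 1%nat) d; auto. apply G; lia. }
        exists o, d'. intros [|t] Ht; [exact G'|].
        apply metric_ext with (E (Datatypes.S t)) d; [tauto| |apply G; lia].
        intros x Ex. apply Hd. apply (erosion_mono E H 1 (Datatypes.S t)) in Ex; [|lia].
        apply Q, Ex.
Qed.

(** * Runs of points with two parents *)

Definition par (E : point -> Prop) (d : point -> nat) (x y : point) : Prop :=
  E y /\ adj x y /\ d x = (d y + 1)%nat.

Definition sib (E : point -> Prop) (d : point -> nat) (x y : point) : Prop :=
  E y /\ adj x y /\ d x = d y.

(* [run E d u t x m]: walking from [x] in direction [t] along siblings with two parents each, at
   offsets [u] and [u - t], stops after at most [m] steps. *)
Inductive run (E : point -> Prop) (d : point -> nat) (u t : point) : point -> nat -> Prop :=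
| run_one x m a : (forall y, par E d x y -> y = a) -> run E d u t x m
| run_end x m : par E d x (x +v u) -> par E d x (x +v (u -v t)) ->
    ~ sib E d x (x +v t) -> run E d u t x m
| run_step x m : par E d x (x +v u) -> par E d x (x +v (u -v t)) ->
    sib E d x (x +v t) -> run E d u t (x +v t) m -> run E d u t x (Datatypes.S m).

Lemma run_mono E d u t x m : run E d u t x m -> forall m', (m <= m')%nat -> run E d u t x m'.
Proof.
  induction 1; intros m' L.
  - eapply run_one; eauto.
  - apply run_end; auto.
  - destruct m' as [|m']; [lia|]. apply run_step; auto. apply IHrun. lia.
Qed.

Lemma vadd_inj (x p q : point) : x +v p = x +v q -> p = q.
Proof.
  intros Q. apply (f_equal fst) in Q as Q1. apply (f_equal snd) in Q as Q2. simpl in *. pt.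
Qed.

Lemma frame_left (u t : point) : frame u t -> frame u (u -v t).
Proof. unfold frame, unit; simpl; lia. Qed.

Lemma frame_turn (u t : point) : frame u t -> frame (u -v t) ((0, 0) -v t).
Proof. unfold frame, unit; simpl; lia. Qed.

Lemma unit_frame (c : point) : unit c -> exists u, frame u c.
Proof.
  intros H. exists (fst c + snd c, - fst c). revert H. unfold frame, unit; simpl; lia.
Qed.

Ltac neqf F := let Q := fresh in let Q1 := fresh in let Q2 := fresh in
  intros Q; apply vadd_inj in Q;
  apply (f_equal fst) in Q as Q1; apply (f_equal snd) in Q as Q2; clear Q;
  clear - F Q1 Q2; frames F; simpl in *; lia.

Section Metric.
Variables (E : point -> Prop) (o : point) (d : point -> nat).
Hypothesis G : metric E o d.

Notation par := (par E d).
Notation sib := (sib E d).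
Notation run := (run E d).

Lemma zero_origin x : E x -> d x = 0%nat -> x = o.
Proof.
  intros Ex D. apply NNPP. intros N.
  destruct (parent _ _ _ G x Ex N) as (y & _ & _ & D'). lia.
Qed.

(** Parents are pairwise adjacent, and no four lattice points are. *)
Lemma two_parents x u t y : E x -> frame u t ->
  par x (x +v u) -> par x (x +v (u -v t)) -> par x y -> y = x +v u \/ y = x +v (u -v t).
Proof.
  intros Ex F (E1 & A1 & D1) (E2 & A2 & D2) (Ey & Ay & Dy).
  destruct (point_eq_dec y (x +v u)) as [|N1]; auto.
  destruct (point_eq_dec y (x +v (u -v t))) as [|N2]; auto.
  exfalso.
  pose proof (parents_adj _ _ _ G x _ _ Ex Ey E1 Ay A1 Dy D1 N1) as B1.
  pose proof (parents_adj _ _ _ G x _ _ Ex Ey E2 Ay A2 Dy D2 N2) as B2.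
  assert (F' : frame (u -v t) u) by (fr F).
  destruct (common_neighbours (u -v t) u x y F' Ay (adj_sym _ _ B1)) as [-> | ->].
  - contradiction.
  - clear - F B2. frames F; geo.
Qed.

Lemma sib_parent x u t : E x -> frame u t -> sib x (x +v t) ->
  exists p, par x p /\ par (x +v t) p /\ (p = x +v u \/ p = x +v (t -v u)).
Proof.
  intros Ex F (Es & As & Ds).
  destruct (triangle _ _ _ G x _ Ex Es As Ds) as (p & Ep & A1 & A2 & Dp).
  exists p. repeat split; auto. lia. apply common_neighbours; auto.
Qed.

(** The run of a child follows the run of its parent: as long as the siblings of [x] have two
    parents, these parents are consecutive points of the run of [p]. *)
Lemma run_child u t p m : frame u t -> run u t p m ->
  forall x, E x -> par x (x +v u) -> par x (x +v (u -v t)) -> p = x +v u ->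
  run u t x (Datatypes.S m).
Proof.
  intros F R. induction R as [p m a One|p m P1 P2 NS|p m P1 P2 PS R IH]; intros x Ex X1 X2 Ep.
  1, 2, 3: destruct (classic (sib x (x +v t))) as [XS|NXS]; [|apply run_end; auto; fail].
  (* The parent shared by [x] and [x + t] can only be [p]; below, a second parent [q] of [x + t]
     must be [p + t], a sibling of [p]. *)
  1, 2, 3: assert (Y1 : par (x +v t) p) by
    (destruct (sib_parent x u t Ex F XS) as (r & R1 & R2 & Hr);
     destruct (two_parents x u t r Ex F X1 X2 R1) as [-> | ->];
     [rewrite Ep; exact R2|exfalso; destruct Hr as [Hr|Hr]; revert Hr; neqf F]).
  1, 2, 3: destruct (classic (exists q, par (x +v t) q /\ q <> p)) as [(q & Yq & Nq)|NoQ];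
    [|apply run_step; auto; apply run_one with p; intros y Py; apply NNPP; intros N;
      apply NoQ; eauto; fail].
  1, 2, 3: assert (Qa : p = x +v t +v (u -v t)) by (subst p; pt).
  1, 2, 3: assert (Eq : q = p +v t) by
    (destruct Y1 as (Epp & Ap & Dp), Yq as (Eqq & Aq & Dq), XS as (Ey & Ay & Dy);
     assert (Apq : adj p q) by (apply (parents_adj _ _ _ G (x +v t)); auto);
     destruct (common_neighbours' (x +v t) p q u (u -v t) (frame_left _ _ F) Qa Aq Apq)
       as [Q |Q];
     [rewrite Q, Qa; pt|exfalso; assert (Q' : q = x) by (rewrite Q; pt); rewrite Q' in Dq; lia]).
  1, 2, 3: assert (PS' : sib p (p +v t)) by
    (rewrite <- Eq; destruct Y1 as (Epp & Ap & Dp), Yq as (Eqq & Aq & Dq);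
     split; [auto|split; [rewrite Eq; apply adj_vadd, F|lia]]).
  (* Having siblings on both sides, [p] shares a different parent with each, so it cannot have just
     one. *)
  - exfalso. destruct X1 as (Xa & Xb & Xc), X2 as (Xd & Xe & Xf).
    rewrite <- Ep in Xa, Xc.
    assert (Q1 : par p (p +v u)).
    { destruct (sib_parent p u t Xa F PS') as (r & R1 & _ & [-> | ->]); auto.
      exfalso. destruct R1 as (_ & _ & R1). destruct XS as (_ & _ & XS).
      replace (p +v (t -v u)) with (x +v t) in R1 by (subst p; pt). lia. }
    assert (Q2 : par p (p +v (u -v t))).
    { assert (Fm := frame_turn _ _ F).
      destruct (sib_parent p (u -v t) ((0,0) -v t) Xa Fm) as (r & R1 & _ & [-> | ->]); auto.
      - replace (p +v ((0, 0) -v t)) with (x +v (u -v t)) by (subst p; pt).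
        split; [auto|split; [|lia]]. subst p. clear - F. frames F; geo.
      - exfalso. destruct R1 as (_ & _ & R1).
        replace (p +v ((0, 0) -v t -v (u -v t))) with x in R1 by (subst p; pt). lia. }
    assert (Q : p +v u = p +v (u -v t)) by (rewrite (One _ Q1), (One _ Q2); auto).
    revert Q. neqf F.
  - contradiction.
  - apply run_step; auto. apply IH.
    + apply XS.
    + replace (x +v t +v u) with q by (subst q p; pt). exact Yq.
    + replace (x +v t +v (u -v t)) with p by (subst p; pt). exact Y1.
    + subst p. pt.
Qed.

(** Descending to the parent in direction [u] lowers the level by one and, by [run_child], the run
    by at most one. *)
Lemma run_bound_oriented n : forall x u t, d x = n -> E x -> x <> o -> frame u t ->
  par x (x +v u) -> par x (x +v (u -v t)) -> run u t x n.
Proof.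
  induction n as [|n IH]; intros x u t Dx Ex Nx F P1 P2.
  { exfalso. apply Nx, zero_origin; auto. }
  apply run_child with (x +v u); auto.
  destruct P1 as (E1 & A1 & D1), P2 as (E2 & A2 & D2).
  set (p := x +v u) in *. set (p' := x +v (u -v t)) in *.
  assert (Npp : p <> p') by (unfold p, p'; neqf F).
  assert (Np : p <> o).
  { intros Q. apply Npp. rewrite Q. symmetry. apply zero_origin; auto.
    rewrite Q, (origin_zero _ _ _ G) in D1. lia. }
  assert (Ep' : p' = p +v ((0, 0) -v t)) by (unfold p, p'; pt).
  assert (App : adj p p') by (apply (parents_adj _ _ _ G x); auto).
  assert (Q2 : par p (p +v (u -v t))).
  { assert (Fm := frame_turn _ _ F).
    destruct (sib_parent p (u -v t) ((0,0) -v t) E1 Fm) as (r & R1 & _ & [-> | ->]); auto.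
    - rewrite <- Ep'. split; [auto|split; [auto|lia]].
    - exfalso. destruct R1 as (_ & _ & R1).
      replace (p +v ((0, 0) -v t -v (u -v t))) with x in R1 by (unfold p; pt). lia. }
  destruct (classic (exists q, par p q /\ q <> p +v (u -v t))) as [(q & Pq & Nq)|NoQ].
  - apply IH; auto; [lia|].
    assert (A : adj (p +v (u -v t)) q).
    { destruct Q2 as (Ea & Aa & Da), Pq as (Eb & Ab & Db).
      apply (parents_adj _ _ _ G p); auto. }
    destruct (common_neighbours u (u -v t) p q (frame_left _ _ F) (proj1 (proj2 Pq)) A) as [-> |Q].
    + exact Pq.
    + exfalso. assert (q = p') by (rewrite Q, Ep'; pt). destruct Pq as (_ & _ & Db). rewrite H in Db. lia.
  - apply run_one with (p +v (u -v t)). intros y Py. apply NNPP. intros N. eauto.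
Qed.

Lemma run_bound x : E x -> x <> o -> exists u t, frame u t /\ run u t x (d x).
Proof.
  intros Ex Nx. destruct (parent _ _ _ G x Ex Nx) as (a & Ea & Aa & Da).
  destruct (classic (exists b, par x b /\ b <> a)) as [(b & (Eb & Ab & Db) & Nb)|NoB].
  - assert (Aab : adj a b) by (apply (parents_adj _ _ _ G x); auto).
    exists (a -v x), ((a -v x) -v (b -v x)).
    assert (F := frame_left _ _ (frame_of_adj x a b Aa Ab Aab)). split; [exact F|].
    apply run_bound_oriented; auto.
    + replace (x +v (a -v x)) with a by pt. repeat split; auto.
    + replace (x +v (a -v x -v (a -v x -v (b -v x)))) with b by pt. repeat split; auto.
  - exists (1, 0), (1, -1). split; [unfold frame, unit; simpl; lia|].
    apply run_one with a. intros y Py. apply NNPP. intros N. eauto.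
Qed.

(** If [c] has a second parent [q], then [q] is a sibling of [x]. If [q] lies behind the run of [x],
    the run of [c] follows that of [x]; if [q] lies ahead, it is the next point of the run, and the
    run of [c] follows that of [q]. *)
Lemma run_next_level x c u t m : E x -> E c -> par c x -> frame u t -> run u t x m ->
  exists u' t', frame u' t' /\ run u' t' c (Datatypes.S m).
Proof.
  intros Ex Ec (_ & Ax & Dx) F R.
  destruct (classic (exists q, par c q /\ q <> x)) as [(q & (Eq & Aq & Dq) & Nq)|NoQ].
  2:{ exists u, t. split; [exact F|]. apply run_one with x. intros y Py. apply NNPP. intros N. eauto. }
  assert (Axq : adj x q) by (apply (parents_adj _ _ _ G c); auto).
  set (u1 := x -v c). set (t1 := u1 -v (q -v c)).
  assert (F1 : frame u1 t1) by (apply frame_left, frame_of_adj; auto).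
  assert (C1 : par c (c +v u1)).
  { replace (c +v u1) with x by (unfold u1; pt). repeat split; auto. }
  assert (C2 : par c (c +v (u1 -v t1))).
  { replace (c +v (u1 -v t1)) with q by (unfold t1, u1; pt). repeat split; auto. }
  assert (Px : par x (x +v (u1 -v t1))).
  { assert (Fm : frame (u1 -v t1) ((0, 0) -v t1)) by (apply frame_turn, F1).
    assert (Eqx : x +v ((0, 0) -v t1) = q) by (unfold t1, u1; pt).
    destruct (sib_parent x (u1 -v t1) ((0,0) -v t1) Ex Fm) as (r & R1 & _ & [-> | ->]); auto.
    - rewrite Eqx. split; [auto|split; [auto|lia]].
    - exfalso. destruct R1 as (_ & _ & R1).
      replace (x +v ((0, 0) -v t1 -v (u1 -v t1))) with c in R1 by (unfold t1, u1; pt). lia. }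
  assert (Xq : x = c +v u1) by (unfold u1; pt).
  assert (Qq : q = c +v (u1 -v t1)) by (unfold t1, u1; pt).
  clearbody u1 t1.
  assert (Base : (exists a, forall y, par x y -> y = a) -> run u1 t1 c (Datatypes.S m)).
  { intros [a One]. apply run_child with x; auto. apply run_one with a. exact One. }
  assert (Two : par x (x +v u) -> par x (x +v (u -v t)) ->
     (u1 = u /\ t1 = t) \/ (sib x (x +v t) /\ c +v u = x +v t /\ c +v (u -v t) = x)).
  { intros P1 P2. destruct (two_parents x u t _ Ex F P1 P2 Px) as [Q|Q]; apply vadd_inj in Q.
    - right.
      assert (Arq : adj (x +v u) q).
      { rewrite <- Q, Xq, Qq. clear -F1. frames F1; geo. }
      destruct (common_neighbours t u x q (frame_sym _ _ F) Axq Arq) as [Q'|Q'].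
      + split; [rewrite <- Q'; repeat split; auto; lia|]. rewrite <- Q'. split.
        * rewrite Qq, Q. auto.
        * rewrite Xq, Qq in Q'. rewrite Xq.
          apply (f_equal fst) in Q' as Q1. apply (f_equal snd) in Q' as Q2.
          apply (f_equal fst) in Q as Q3. apply (f_equal snd) in Q as Q4. pt.
      + exfalso. destruct P2 as (_ & _ & P2). rewrite <- Q' in P2. lia.
    - left.
      assert (Arq : adj (x +v (u -v t)) q).
      { rewrite <- Q, Xq, Qq. clear -F1. frames F1; geo. }
      destruct (common_neighbours u (u -v t) x q (frame_left _ _ F) Axq Arq) as [Q'|Q'].
      + exfalso. destruct P1 as (_ & _ & P1). rewrite <- Q' in P1. lia.
      + rewrite Xq, Qq in Q'.
        apply (f_equal fst) in Q' as Q1. apply (f_equal snd) in Q' as Q2.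
        apply (f_equal fst) in Q as Q3. apply (f_equal snd) in Q as Q4. split; pt. }
  destruct R as [x m a One|x m P1 P2 NS|x m P1 P2 XS R'].
  - exists u1, t1. split; eauto.
  - destruct (Two P1 P2) as [[-> ->]|(XS & _)]; [|contradiction].
    exists u, t. split; auto. apply run_child with x; auto. apply run_end; auto.
  - destruct (Two P1 P2) as [[-> ->]|(_ & Q1 & Q2)].
    + exists u, t. split; auto. apply run_child with x; auto. apply run_step; auto.
    + exists u, t. split; auto. apply run_mono with (Datatypes.S m); [|lia].
      destruct XS as (Es & _ & Ds). apply run_child with (x +v t); auto.
      * rewrite Q1. split; [auto|split; [|lia]]. rewrite <- Q1. apply adj_vadd, F.
      * rewrite Q2. repeat split; auto.
Qed.
End Metric.

(** * SCE points among points without children *)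

Section Convexity.
Variables (E0 E : point -> Prop) (o : point) (d : point -> nat) (x : point).
Hypotheses (G0 : metric E0 o d) (G : metric E o d) (Sub : forall z, E z -> E0 z)
  (HF : hole_free E) (Ex : E x) (Nx : x <> o)
  (Childless : forall z, E z -> adj x z -> d z <> (d x + 1)%nat).

Let level z : E z -> adj x z -> par E d x z \/ sib E d x z.
Proof.
  intros Ez A. pose proof (lipschitz _ _ _ G x z Ex Ez A).
  pose proof (lipschitz _ _ _ G z x Ez Ex (adj_sym _ _ A)). pose proof (Childless z Ez A).
  assert (C : d x = (d z + 1)%nat \/ d x = d z) by lia.
  unfold par, sib. tauto.
Qed.

Let par_sub y z : par E d y z -> par E0 d y z.
Proof. intros (Ez & A & D). repeat split; auto. Qed.

Lemma one_parent_SCE a : (forall y, par E0 d x y -> y = a) -> SCE E x.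
Proof.
  intros One. destruct (parent _ _ _ G x Ex Nx) as (a' & Ea & Aa & Da).
  assert (a' = a) by (apply One; repeat split; auto). subst a'.
  destruct (unit_frame (a -v x)) as [u F]; [apply adj_unit, Aa|].
  assert (Q : x +v (a -v x) = a) by pt.
  apply arc_SCE with u (a -v x); auto. split; [exact F|]. rewrite Q. split; [|auto].
  intros z Az Ez. destruct (level z Ez Az) as [P|(_ & _ & D)].
  - right; left. apply One, par_sub, P.
  - destruct (triangle _ _ _ G x z Ex Ez Az D) as (p & Ep & A1 & A2 & Dp).
    assert (p = a) by (apply One; repeat split; auto). subst p.
    destruct (common_neighbours u (a -v x) x z) as [-> | ->]; auto. rewrite Q. auto using adj_sym.
Qed.

(** Parents are named in [E0] because some may already be gone from [E]. Siblings still share a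
    surviving parent, so without [x + t] all neighbours lie in the arc [u], [u - t], [-t]. *)
Lemma run_end_SCE u t : frame u t -> par E0 d x (x +v u) -> par E0 d x (x +v (u -v t)) ->
  (E (x +v t) -> sib E d x (x +v t) -> False) -> SCE E x.
Proof.
  intros F P1 P2 NS. apply arc_SCE with u (u -v t); auto.
  assert (Sp : forall z, E z -> adj x z -> d x = d z ->
     (E (x +v u) /\ adj z (x +v u)) \/ (E (x +v (u -v t)) /\ adj z (x +v (u -v t)))).
  { intros z Ez Az D. destruct (triangle _ _ _ G x z Ex Ez Az D) as (p & Ep & A1 & A2 & Dp).
    destruct (two_parents _ _ _ G0 x u t p (Sub _ Ex) F P1 P2) as [-> | ->]; auto.
    repeat split; auto. }
  split; [apply frame_left, F|]. split.
  - intros z Az Ez. destruct (level z Ez Az) as [P|S].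
    + destruct (two_parents _ _ _ G0 x u t z (Sub _ Ex) F P1 P2) as [-> | ->]; auto.
    + destruct (Sp z Ez Az (proj2 (proj2 S))) as [[_ A]|[_ A]].
      * destruct (common_neighbours t u x z (frame_sym _ _ F) Az (adj_sym _ _ A)) as [-> | ->]; auto.
        exfalso. auto.
      * destruct (common_neighbours u (u -v t) x z (frame_left _ _ F) Az (adj_sym _ _ A)); auto.
  (* The sibling [x - t] shares a parent with [x] that is still in [E], and this parent is the
     middle of the arc. *)
  - intros _ Es. assert (As : adj x (x +v (u -v t -v u))) by (clear -F; frames F; geo).
    destruct (level _ Es As) as [P|(_ & _ & D)].
    + exfalso. destruct (two_parents _ _ _ G0 x u t _ (Sub _ Ex) F P1 P2 (par_sub _ _ P)) as [Q|Q];
        revert Q; neqf F.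
    + destruct (Sp _ Es As D) as [[_ A]|[Em _]]; [|exact Em].
      exfalso. clear -F A. frames F; geo.
Qed.
End Convexity.

(** * The area of a shape *)

Lemma SP_bounded n pos : exists K, bounded K (SP n pos).
Proof.
  induction n as [|n [K IH]].
  - exists 0. intros x (p & Hp & _). lia.
  - exists (Z.abs K + Z.abs (fst (pos n)) + Z.abs (snd (pos n))).
    intros x (p & Hp & <-). destruct (Nat.eq_dec p n) as [->|N]; [lia|].
    specialize (IH (pos p)). destruct IH as [H1 H2]; [exists p; split; [lia|auto]|]. lia.
Qed.

Lemma area_in (A : point -> Prop) x : A x -> area A x.
Proof. intros Ax [N _]. auto. Qed.

Lemma row_walk_signed (A : point -> Prop) (x y s : Z) (n : nat) : s = 1 \/ s = -1 ->
  (forall j, (j <= n)%nat -> A (x + s * Z.of_nat j, y)) ->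
  walk A (x, y) (x + s * Z.of_nat n, y) n.
Proof.
  intros Hs H. destruct Hs as [-> | ->].
  - replace (x + 1 * Z.of_nat n) with (x + Z.of_nat n) by lia. apply row_walk.
    intros j Hj. specialize (H (Z.to_nat (j - x)) ltac:(lia)).
    replace (x + 1 * Z.of_nat (Z.to_nat (j - x))) with j in H by lia. exact H.
  - apply walk_rev. replace x with ((x + -1 * Z.of_nat n) + Z.of_nat n) at 2 by lia.
    apply row_walk. intros j Hj. specialize (H (Z.to_nat (x - j)) ltac:(lia)).
    replace (x + -1 * Z.of_nat (Z.to_nat (x - j))) with j in H by lia. exact H.
Qed.

(** A ray that never met [A] would place its origin in the outer face; before the first hit it stays
    in the area. *)
Lemma area_ray (A : point -> Prop) (x y s : Z) : s = 1 \/ s = -1 -> area A (x, y) ->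
  exists k, A (x + s * Z.of_nat k, y) /\
    forall j, (j <= k)%nat -> area A (x + s * Z.of_nat j, y).
Proof.
  intros Hs Ax. destruct (classic (exists k, A (x + s * Z.of_nat k, y))) as [Ex|No].
  - destruct (least _ Ex) as (k & Hk & Hmin). exists k. split; [exact Hk|].
    induction j as [|j IH]; intros Hj.
    + replace (x + s * Z.of_nat 0) with x by lia. exact Ax.
    + intros O. apply IH; [lia|]. apply outer_adj with (x + s * Z.of_nat (Datatypes.S j), y); auto.
      apply adj_unit. unfold unit. cbn [fst snd vsub]. destruct Hs as [-> | ->]; lia.
  - exfalso. apply Ax. assert (N : forall k, ~ A (x + s * Z.of_nat k, y)) by eauto.
    split.
    + specialize (N 0%nat). replace (x + s * Z.of_nat 0) with x in N by lia. exact N.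
    + intros B. set (m := Z.to_nat (Z.abs B + Z.abs x + 1)).
      exists (x + s * Z.of_nat m, y), m. split.
      * cbn [fst snd]. destruct Hs as [-> | ->]; lia.
      * apply row_walk_signed; auto.
Qed.

Lemma area_shape K A : bounded K A -> connected_set A -> shape K (area A).
Proof.
  intros HB HC. split; [|split].
  - intros [x y] Ax.
    destruct (area_ray A x y 1 ltac:(auto) Ax) as (k & Hk & _).
    destruct (area_ray A x y (-1) ltac:(auto) Ax) as (j & Hj & _).
    apply HB in Hk, Hj. cbn [fst snd] in *. lia.
  - assert (R : forall x, area A x -> exists p k, A p /\ walk (area A) x p k).
    { intros [x y] Ax. destruct (area_ray A x y 1 ltac:(auto) Ax) as (k & Hk & Hj).
      exists (x + 1 * Z.of_nat k, y), k. split; auto. apply row_walk_signed; auto. }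
    intros x y Ax Ay. destruct (R x Ax) as (p & k & Ap & Wp). destruct (R y Ay) as (q & j & Aq & Wq).
    destruct (HC p q Ap Aq) as [i W].
    eexists. eapply walk_trans; [exact Wp|]. eapply walk_trans; [|apply walk_rev; exact Wq].
    eapply walk_mono; [|exact W]. apply area_in.
  - intros x Nx. apply NNPP in Nx. split; [intros H; auto|]. destruct Nx as [N O].
    intros B. destruct (O B) as (y & k & Far & W). exists y, k. split; [exact Far|].
    assert (Oy : outer A y).
    { split; [eapply walk_end in W; exact W|]. intros B'.
      destruct (O B') as (y' & k' & Far' & W'). exists y', (k + k')%nat. split; [exact Far'|].
      eapply walk_trans; [apply walk_rev; exact W|exact W']. }
    clear - W Oy. induction W as [u Nu|u w y k Nu Ad W IH].
    + constructor. intros H. auto.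
    + specialize (IH Oy). apply walkS with w; auto. intros H. apply H.
      apply outer_adj with w; auto. apply walk_start in IH. apply NNPP in IH. exact IH.
Qed.

Lemma walk_horizontal A u v k : walk A u v k -> Z.abs (fst v - fst u) <= Z.of_nat k.
Proof.
  induction 1 as [|u v w k _ Ad _ IH]; [lia|].
  apply adj_unit in Ad. unfold unit in Ad. cbn [fst snd vsub] in Ad. lia.
Qed.

(** The horizontal rays to both sides hit [A]. The two hits are joined by a walk of length at most
    [D], which bounds their horizontal separation. *)
Lemma area_near (A : point -> Prop) D x : diam_le A (area A) D -> area A x ->
  exists p k, (k <= D)%nat /\ A p /\ walk (area A) x p k.
Proof.
  intros HD Ax. destruct x as [x y].
  destruct (area_ray A x y 1 ltac:(auto) Ax) as (k & Hk & Rk).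
  destruct (area_ray A x y (-1) ltac:(auto) Ax) as (j & Hj & _).
  destruct (HD _ _ Hj Hk) as (i & Li & W). apply walk_horizontal in W. cbn [fst snd] in W.
  exists (x + 1 * Z.of_nat k, y), k. split; [lia|]. split; [exact Hk|].
  apply row_walk_signed; auto.
Qed.

Lemma area_diam (A : point -> Prop) D : diam_le A (area A) D -> diam_le (area A) (area A) (3 * D).
Proof.
  intros HD x y Ax Ay.
  destruct (area_near A D x HD Ax) as (p & k & Lk & Ap & Wp).
  destruct (area_near A D y HD Ay) as (q & j & Lj & Aq & Wq).
  destruct (HD p q Ap Aq) as (i & Li & W). exists (k + (i + j))%nat. split; [lia|].
  eapply walk_trans; [exact Wp|]. eapply walk_trans; [exact W|]. apply walk_rev. exact Wq.
Qed.

Lemma metric_walk E o d x y k : metric E o d -> walk E x y k -> (d y <= d x + k)%nat.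
Proof.
  intros G W. induction W as [|u v w k Eu Ad W IH]; [lia|].
  pose proof (lipschitz _ _ _ G u v Eu (walk_start _ _ _ _ W) Ad). lia.
Qed.

(** * Invariants of the algorithm *)

(** An end of the arc is adjacent to a free neighbour of [v]. So removing [v] newly exposes at most
    the middle point. *)
Lemma interior_is_middle E v u c x : arc E v u c -> adj v x -> E x ->
  (forall y, adj x y -> E y) -> x = v +v c.
Proof.
  intros (F & Nb & _) A Ex Int. destruct (Nb x A Ex) as [-> |[-> | ->]]; auto; exfalso.
  - assert (H : adj (v +v u) (v -v (c -v u))) by (clear -F; frames F; geo).
    assert (H' : adj v (v -v (c -v u))) by (clear -F; frames F; geo).
    destruct (Nb _ H' (Int _ H)) as [Q|[Q|Q]];
      apply (f_equal fst) in Q as Q1; apply (f_equal snd) in Q as Q2;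
      clear -F Q1 Q2; frames F; simpl in *; lia.
  - assert (H : adj (v +v (c -v u)) (v -v u)) by (clear -F; frames F; geo).
    assert (H' : adj v (v -v u)) by (clear -F; frames F; geo).
    destruct (Nb _ H' (Int _ H)) as [Q|[Q|Q]];
      apply (f_equal fst) in Q as Q1; apply (f_equal snd) in Q as Q2;
      clear -F Q1 Q2; frames F; simpl in *; lia.
Qed.

(** [boundary_occupied] drives the progress argument: every SCE point carries a particle able to
    remove it, and an unoccupied eligible point has only eligible neighbours. *)
Record invariant (K : Z) (n : nat) (X : Config) : Prop := {
  undecided_eligible : forall p, (p < n)%nat -> stat (st X p) = Undecided ->
    Se X (head (st X p)) /\
    forall d, (d < 6)%nat -> (elig (st X p) d <-> Se X (nb (head (st X p)) d));
  heads_distinct : forall p q, (p < n)%nat -> (q < n)%nat ->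
    head (st X p) = head (st X q) -> p = q;
  tail_removed : forall p w, (p < n)%nat -> tail (st X p) = Some w -> ~ Se X w;
  boundary_occupied : forall x y, Se X x -> adj x y -> ~ Se X y ->
    exists p, (p < n)%nat /\ head (st X p) = x;
  follower_removed : forall p, (p < n)%nat -> stat (st X p) = Follower ->
    ~ Se X (head (st X p));
  leader_alone : forall p, (p < n)%nat -> stat (st X p) = Leader ->
    forall x, Se X x -> x = head (st X p);
  final_decided : forall p, (p < n)%nat -> final (st X p) = true ->
    stat (st X p) <> Undecided /\ tail (st X p) = None;
  eligible_shape : shape K (Se X);
  eligible_nonempty : exists x, Se X x }.

Lemma setp_same f p s : setp f p s p = s.
Proof. unfold setp. destruct (Nat.eq_dec p p); congruence. Qed.

Lemma setp_other f p s q : q <> p -> setp f p s q = f q.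
Proof. unfold setp. destruct (Nat.eq_dec q p); congruence. Qed.

Section Steps.
Variables (K : Z) (n : nat) (X : Config).
Hypothesis I : invariant K n X.

Lemma unoccupied_interior u y : Se X u -> ~ occupied n X u -> adj u y -> Se X y.
Proof.
  intros Su Nu A. apply NNPP. intros Ny.
  destruct (boundary_occupied _ _ _ I u y Su A Ny) as (p & Hp & Q).
  apply Nu. exists p. split; auto. left. exact Q.
Qed.

Lemma invariant_local p s : (p < n)%nat -> head s = head (st X p) -> tail s = None ->
  (stat s = Undecided -> stat (st X p) = Undecided) -> elig s = elig (st X p) ->
  (stat s = Follower -> stat (st X p) = Follower) ->
  (stat s = Leader -> forall x, Se X x -> x = head s) ->
  (final s = true -> stat s <> Undecided) ->
  invariant K n (mkConfig (setp (st X) p s) (Se X)).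
Proof.
  intros Hp Hh Ht Hu He Hf Hl Hfin.
  assert (Hd : forall q, head (setp (st X) p s q) = head (st X q)).
  { intros q. destruct (Nat.eq_dec q p) as [->|N].
    - rewrite setp_same. exact Hh.
    - rewrite setp_other; auto. }
  split; cbn [st Se]; try (intros q; intros; destruct (Nat.eq_dec q p) as [->|N];
    [rewrite setp_same in *|rewrite setp_other in * by exact N]).
  - rewrite Hh, He. apply (undecided_eligible _ _ _ I); auto.
  - apply (undecided_eligible _ _ _ I); auto.
  - apply (heads_distinct _ _ _ I); auto. rewrite <- !Hd. rewrite setp_same. assumption.
  - apply (heads_distinct _ _ _ I); auto. rewrite <- (Hd q0). assumption.
  - congruence.
  - eapply (tail_removed _ _ _ I); eauto.
  - intros x y Sx A Ny. destruct (boundary_occupied _ _ _ I x y) as (r & Hr & Q); auto.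
    exists r. rewrite Hd. auto.
  - rewrite Hh. apply (follower_removed _ _ _ I); auto.
  - apply (follower_removed _ _ _ I); auto.
  - auto.
  - apply (leader_alone _ _ _ I); auto.
  - auto.
  - apply (final_decided _ _ _ I); auto.
  - apply (eligible_shape _ _ _ I).
  - apply (eligible_nonempty _ _ _ I).
Qed.

Lemma some_eligible p : (p < n)%nat -> stat (st X p) = Undecided ->
  ~ all_ineligible (st X p) -> exists z, adj (head (st X p)) z /\ Se X z.
Proof.
  intros Hp Hu H. apply NNPP. intros No. apply H. intros d Hd Ed. apply No.
  exists (nb (head (st X p)) d). split; [apply nb_adj, Hd|].
  apply (undecided_eligible _ _ _ I p Hp Hu); auto.
Qed.

Lemma invariant_remove p s : (p < n)%nat -> SCE (Se X) (head (st X p)) ->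
  (exists z, adj (head (st X p)) z /\ Se X z) ->
  final s = false ->
  (stat s = Undecided /\ tail s = Some (head (st X p)) /\
     adj (head (st X p)) (head s) /\ Se X (head s) /\ ~ occupied n X (head s) /\
     (forall d, elig s d <-> nb (head s) d <> head (st X p)) \/
   stat s = Follower /\ tail s = None /\ head s = head (st X p) /\
     forall u, adj (head (st X p)) u -> Se X u -> occupied n X u) ->
  invariant K n (mkConfig (setp (clear_v (st X) (head (st X p))) p s)
    (fun x => Se X x /\ x <> head (st X p))).
Proof.
  intros Hp HS (z & Az & Sz) Hfin Hs. set (v := head (st X p)) in *.
  destruct (SCE_arc _ _ HS) as (Sv & _ & u & c & Ar).
  assert (Dist : forall q, (q < n)%nat -> q <> p -> head (st X q) <> v).
  { intros q Hq N Q. apply N, (heads_distinct _ _ _ I); auto. }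
  assert (New : forall q, (q < n)%nat -> q <> p -> head (st X q) <> head s).
  { intros q Hq N Q. destruct Hs as [(_ & _ & _ & _ & No & _)|(_ & _ & Hh & _)].
    - apply No. exists q. split; auto. left. exact Q.
    - apply (Dist q Hq N). congruence. }
  split; cbn [st Se].
  - intros q Hq. destruct (Nat.eq_dec q p) as [->|N].
    + rewrite setp_same. intros Hu. destruct Hs as [(_ & _ & A & Sh & No & He)|(Q & _)]; [|congruence].
      split.
      * split; auto. intros Q. rewrite Q in A. eapply adj_irrefl; eauto.
      * intros d Hd. rewrite He. split; [|tauto]. intros Nd. split; auto.
        (* The target of the expansion is unoccupied, hence interior, which justifies setting all
           entries except the one back to [v] to true. *)
        apply (unoccupied_interior (head s)); auto. apply nb_adj, Hd.
    + rewrite setp_other by exact N. cbn. intros Hu.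
      destruct (undecided_eligible _ _ _ I q Hq Hu) as [Sq Eq]. split; [split; auto|].
      intros d Hd. rewrite Eq by exact Hd. tauto.
  - intros q r Hq Hr. destruct (Nat.eq_dec q p) as [->|Nq], (Nat.eq_dec r p) as [->|Nr]; auto.
    + rewrite setp_same, setp_other by exact Nr. cbn. intros Q. exfalso. apply (New r); auto.
    + rewrite setp_same, setp_other by exact Nq. cbn. intros Q. exfalso. apply (New q); auto.
    + rewrite !setp_other by assumption. cbn. apply (heads_distinct _ _ _ I); auto.
  - intros q w Hq. destruct (Nat.eq_dec q p) as [->|N].
    + rewrite setp_same. intros Ht [_ Nw].
      destruct Hs as [(_ & Ht' & _)|(_ & Ht' & _)]; congruence.
    + rewrite setp_other by exact N. cbn. intros Ht [Sw _].
      eapply (tail_removed _ _ _ I); eauto.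
  - intros x y [Sx Nx] A Ny.
    assert (Keep : (exists r, (r < n)%nat /\ head (st X r) = x) ->
      exists r, (r < n)%nat /\ head (setp (clear_v (st X) v) p s r) = x).
    { intros (r & Hr & Q). exists r. split; auto.
      rewrite setp_other; [exact Q|]. intros ->. apply Nx. rewrite <- Q. reflexivity. }
    destruct (classic (forall y, adj x y -> Se X y)) as [Int|NInt].
    (* A newly exposed [x] is the middle of the arc. After an expansion the unoccupied target is
       this same point; otherwise [x] was already occupied, and by a head, since tails are not
       eligible. *)
    + assert (y = v).
      { apply NNPP. intros N. apply Ny. split; auto. }
      subst y. destruct Hs as [(_ & _ & Ah & Sh & No & _)|(_ & _ & _ & Occ)].
      * exists p. split; auto. rewrite setp_same.
        rewrite (interior_is_middle _ _ _ _ x Ar); auto using adj_sym.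
        apply (interior_is_middle _ _ _ _ _ Ar); auto.
        intros y. apply unoccupied_interior; auto.
      * apply Keep. destruct (Occ x (adj_sym _ _ A) Sx) as (r & Hr & [Q|Q]); eauto.
        exfalso. eapply (tail_removed _ _ _ I); eauto.
    + apply Keep. apply not_all_ex_not in NInt as [y' Hy']. apply imply_to_and in Hy' as [A' N'].
      eapply (boundary_occupied _ _ _ I); eauto.
  - intros q Hq. destruct (Nat.eq_dec q p) as [->|N].
    + rewrite setp_same. intros Hf [_ Nh].
      destruct Hs as [(Q & _)|(_ & _ & Q & _)]; congruence.
    + rewrite setp_other by exact N. cbn. intros Hf [Sh _].
      eapply (follower_removed _ _ _ I); eauto.
  - intros q Hq. destruct (Nat.eq_dec q p) as [->|N].
    + rewrite setp_same. intros Hl. destruct Hs as [(Q & _)|(Q & _)]; congruence.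
    + rewrite setp_other by exact N. cbn. intros Hl x [Sx _].
      apply (leader_alone _ _ _ I); auto.
  - intros q Hq. destruct (Nat.eq_dec q p) as [->|N].
    + rewrite setp_same. congruence.
    + rewrite setp_other by exact N. cbn. apply (final_decided _ _ _ I); auto.
  - apply shape_remove; auto. apply (eligible_shape _ _ _ I).
  - exists z. split; auto. intros Q. rewrite Q in Az. eapply adj_irrefl; eauto.
Qed.

Lemma ineligible_alone p : (p < n)%nat -> stat (st X p) = Undecided ->
  all_ineligible (st X p) -> forall x, Se X x -> x = head (st X p).
Proof.
  intros Hp Hu Hall x Sx. destruct (undecided_eligible _ _ _ I p Hp Hu) as [Sh He].
  apply NNPP. intros N.
  destruct (connected_neighbour (Se X) (head (st X p)) x) as (z & (d & Hd & ->) & Sz); auto.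
  - apply (eligible_shape _ _ _ I).
  - apply (Hall d Hd), He; auto.
Qed.

Lemma step_invariant p X' : (p < n)%nat -> step n X p X' ->
  invariant K n X' /\ erosion_step (Se X) (Se X').
Proof.
  intros Hp Hst. destruct Hst as [Hf|w Hf Ht s|Hf Ht Hd Hn s|Hf Ht Hd Hn|Hf Ht Hu Ha s
    |u Hf Ht Hu Ha HS A Su No v|Hf Ht Hu Ha HS Occ v f|Hf Ht Hu Ha HS].
  - split; [exact I|left; tauto].
  - split; [|left; cbn; tauto]. apply invariant_local; auto; cbn.
    + apply (leader_alone _ _ _ I p Hp).
    + discriminate.
  - split; [|left; cbn; tauto]. apply invariant_local; auto; cbn.
    apply (leader_alone _ _ _ I p Hp).
  - split; [exact I|left; tauto].
  - split; [|left; cbn; tauto]. apply invariant_local; auto; cbn; try discriminate.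
    intros _. apply ineligible_alone; auto.
  - split.
    + apply invariant_remove; auto.
      * apply some_eligible; auto.
      * left. cbn. repeat split; auto.
    + right. exists v. split; [exact HS|]. split; [apply some_eligible; auto|]. cbn. tauto.
  - split.
    + apply invariant_remove; auto.
      * apply some_eligible; auto.
    + right. exists v. split; [exact HS|]. split; [apply some_eligible; auto|]. cbn. tauto.
  - split; [exact I|left; tauto].
Qed.

Lemma step_other p q X' : step n X p X' -> q <> p ->
  head (st X' q) = head (st X q) /\ tail (st X' q) = tail (st X q) /\
  stat (st X' q) = stat (st X q) /\ final (st X' q) = final (st X q).
Proof. intros Hst N. destruct Hst; cbn [st]; rewrite ?setp_other by exact N; auto. Qed.

(* While [x] is an SCE point that has not been removed, its particle can only be in transit
   (contracting) once. *)
Lemma step_SCE p q x o X' : (p < n)%nat -> (q < n)%nat -> step n X q X' ->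
  head (st X p) = x -> SCE (Se X) x -> Se X o -> x <> o -> Se X' x ->
  head (st X' p) = x /\
  (tail (st X p) = None \/ q = p -> tail (st X' p) = None) /\
  (q = p -> tail (st X p) <> None).
Proof.
  intros Hp Hq Hst Hh HS So N Sx'.
  destruct (Nat.eq_dec p q) as [<-|Npq].
  2:{ destruct (step_other q p X' Hst Npq) as (H1 & H2 & _). rewrite H1, H2.
      split; [exact Hh|]. split; [|congruence]. intros [Q|Q]; congruence. }
  assert (Sx : Se X x) by apply HS.
  assert (NL : stat (st X p) <> Leader).
  { intros Q. pose proof (leader_alone _ _ _ I p Hp Q o So). congruence. }
  assert (NF : stat (st X p) <> Follower).
  { intros Q. apply (follower_removed _ _ _ I p Hp Q). congruence. }
  assert (Un : stat (st X p) = Undecided) by (destruct (stat (st X p)); congruence).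
  assert (NA : ~ all_ineligible (st X p)).
  { intros Q. apply N. rewrite <- Hh. symmetry. apply ineligible_alone; auto. }
  subst x.
  destruct Hst as [Hf|w Hf Ht s|Hf Ht Hd Hn s|Hf Ht Hd Hn|Hf Ht Hu Ha s
    |u Hf Ht Hu Ha HS' A Su No v|Hf Ht Hu Ha HS' Occ v f|Hf Ht Hu Ha HS']; try contradiction.
  - exfalso. apply (final_decided _ _ _ I p Hp Hf). exact Un.
  - cbn [st]. rewrite setp_same. cbn. rewrite Ht. repeat split; auto. discriminate.
  - exfalso. cbn in Sx'. apply Sx'. reflexivity.
  - exfalso. cbn in Sx'. apply Sx'. reflexivity.
Qed.

Lemma step_monotone p q X' : (p < n)%nat -> step n X q X' ->
  (stat (st X p) <> Undecided -> stat (st X' p) <> Undecided) /\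
  (final (st X p) = true -> final (st X' p) = true).
Proof.
  intros Hp Hst. destruct (Nat.eq_dec p q) as [<-|Npq].
  2:{ destruct (step_other q p X' Hst Npq) as (_ & _ & H1 & H2). rewrite H1, H2. auto. }
  destruct Hst; cbn [st]; rewrite ?setp_same; cbn; split; intros; auto; congruence.
Qed.

(** The three claims serve the three closing rounds: contraction, decision, termination. *)
Lemma step_alone p q o X' : (p < n)%nat -> (q < n)%nat -> step n X q X' ->
  (forall x, Se X x -> x = o) ->
  (tail (st X p) = None \/ q = p -> tail (st X' p) = None) /\
  (q = p -> tail (st X p) = None -> stat (st X' p) <> Undecided) /\
  (q = p -> tail (st X p) = None ->
     (forall r, (r < n)%nat -> stat (st X r) <> Undecided) -> final (st X' p) = true).
Proof.
  intros Hp Hq Hst Al. destruct (Nat.eq_dec p q) as [<-|Npq].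
  2:{ destruct (step_other q p X' Hst Npq) as (_ & H2 & _). rewrite H2.
      repeat split; try congruence. intros [Q|Q]; congruence. }
  assert (NA : stat (st X p) = Undecided -> all_ineligible (st X p)).
  { intros Un d Hd Ed. destruct (undecided_eligible _ _ _ I p Hp Un) as [Sh He].
    apply He in Ed; auto. apply Al in Sh, Ed.
    apply (adj_irrefl o). rewrite <- Ed at 2. rewrite <- Sh. apply nb_adj, Hd. }
  destruct Hst as [Hf|w Hf Ht s|Hf Ht Hd Hn s|Hf Ht Hd Hn|Hf Ht Hu Ha s
    |u Hf Ht Hu Ha HS' A Su No v|Hf Ht Hu Ha HS' Occ v f|Hf Ht Hu Ha HS'];
    try (exfalso; auto; fail); cbn [st]; rewrite ?setp_same; cbn.
  - destruct (final_decided _ _ _ I p Hp Hf). auto.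
  - repeat split; congruence.
  - auto.
  - repeat split; auto.
  - repeat split; auto; [discriminate|]. intros _ _ All. exfalso. apply (All p); auto.
Qed.
End Steps.

Lemma initial_invariant n pos X : initial n pos X -> exists K, invariant K n X.
Proof.
  intros (Hn & Inj & Con & HSe & Hp). destruct (SP_bounded n pos) as [K HB].
  assert (At : forall p, (p < n)%nat -> Se X (pos p)).
  { intros p H. apply HSe, area_in. exists p. auto. }
  exists K. split.
  - intros p H _. destruct (Hp p H) as (H1 & _ & _ & _ & H5). rewrite H1.
    split; [auto|]. intros d Hd. rewrite H5 by exact Hd. rewrite HSe. reflexivity.
  - intros p q H H'. destruct (Hp p H) as (-> & _), (Hp q H') as (-> & _). auto.
  - intros p w H. destruct (Hp p H) as (_ & -> & _). discriminate.
  - intros x y Sx A Ny. apply HSe in Sx. rewrite HSe in Ny. apply NNPP in Ny.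
    destruct (classic (SP n pos x)) as [(p & H & <-)|No].
    + exists p. split; auto. apply (Hp p H).
    (* An unoccupied point next to the outer face belongs to the outer face itself. *)
    + exfalso. apply Sx. apply outer_adj with y; auto.
  - intros p H. destruct (Hp p H) as (_ & _ & -> & _). discriminate.
  - intros p H. destruct (Hp p H) as (_ & _ & -> & _). discriminate.
  - intros p H. destruct (Hp p H) as (_ & _ & _ & -> & _). discriminate.
  - apply shape_ext with (area (SP n pos)); [intros x; symmetry; apply HSe|].
    apply area_shape; auto.
  - exists (pos 0%nat). apply At. lia.
Qed.

(** * Counting rounds *)

Lemma round_split n a k t : round_end n a (Datatypes.S k) t ->
  exists s, round_end n a k s /\ covers n a s t.
Proof. intros R. inversion R; subst. eauto. Qed.

Lemma covers_lt n a s t : (0 < n)%nat -> covers n a s t -> (s < t)%nat.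
Proof. intros Hn Hc. destruct (Hc 0%nat Hn) as (r & Hr & _). lia. Qed.

Lemma round_prefix n a j : forall k t, (0 < n)%nat -> round_end n a (j + k) t ->
  exists s, (s <= t)%nat /\ round_end n a k s.
Proof.
  induction j as [|j IH]; intros k t Hn R; [eauto|].
  apply round_split in R as (s & R & Hc). apply covers_lt in Hc; auto.
  destruct (IH k s Hn R) as (r & Lr & Rr). exists r. split; [lia|auto].
Qed.

Section Execution.
Variables (K : Z) (n : nat) (C : nat -> Config) (a : nat -> nat).
Hypotheses (Hn : (0 < n)%nat) (I0 : invariant K n (C 0%nat)) (Ex : execution n C a).

Lemma execution_invariant t : invariant K n (C t).
Proof.
  induction t as [|t IH]; auto. destruct (Ex t) as [Ha Hs].
  apply (step_invariant K n (C t) IH (a t)); auto.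
Qed.

Lemma execution_erosion t : erosion_step (Se (C t)) (Se (C (Datatypes.S t))).
Proof.
  destruct (Ex t) as [Ha Hs].
  apply (step_invariant K n (C t) (execution_invariant t) (a t)); auto.
Qed.

Lemma eligible_mono s t x : (s <= t)%nat -> Se (C t) x -> Se (C s) x.
Proof. apply (erosion_mono (fun t => Se (C t))). apply execution_erosion. Qed.

(** The particle on [x] cannot leave while [x] is eligible. Its activation in the first round leaves
    it contracted, and the one in the second removes [x]; the surviving point [o] rules out its
    becoming leader. *)
Lemma SCE_removed s s1 s2 x o : covers n a s s1 -> covers n a s1 s2 ->
  (forall r, (s <= r <= s2)%nat -> Se (C r) x -> SCE (Se (C r)) x) ->
  Se (C s2) o -> x <> o -> ~ Se (C s2) x.
Proof.
  intros C1 C2 HS So Nxo Sx.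
  pose proof (covers_lt _ _ _ _ Hn C1). pose proof (covers_lt _ _ _ _ Hn C2).
  assert (HS' : forall r, (s <= r <= s2)%nat -> SCE (Se (C r)) x).
  { intros r Hr. apply HS; auto. apply eligible_mono with s2; auto. lia. }
  destruct (SCE_arc _ _ (HS' s ltac:(lia))) as (Sxs & (y & Ay & Ny) & _).
  destruct (boundary_occupied _ _ _ (execution_invariant s) x y Sxs Ay Ny) as (p & Hp & Hh).
  assert (Step : forall r, (s <= r < s2)%nat -> head (st (C r) p) = x ->
    head (st (C (Datatypes.S r)) p) = x /\
    (tail (st (C r) p) = None \/ a r = p -> tail (st (C (Datatypes.S r)) p) = None) /\
    (a r = p -> tail (st (C r) p) <> None)).
  { intros r Hr Q. destruct (Ex r) as [Ha Hst].
    apply (step_SCE K n (C r) (execution_invariant r) p (a r) x o); auto.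
    - apply HS'. lia.
    - apply eligible_mono with s2; auto. lia.
    - apply eligible_mono with s2; auto. lia. }
  assert (Heads : forall r, (s <= r)%nat -> (r <= s2)%nat -> head (st (C r) p) = x).
  { intros r Lr. induction Lr as [|r Lr IH]; intros Lr'; [exact Hh|].
    apply Step; [lia|]. apply IH. lia. }
  destruct (C1 p Hp) as (r1 & Hr1 & E1). destruct (C2 p Hp) as (r2 & Hr2 & E2).
  assert (Tails : forall r, (Datatypes.S r1 <= r)%nat -> (r <= s2)%nat -> tail (st (C r) p) = None).
  { intros r Lr. induction Lr as [|r Lr IH]; intros Lr'.
    - apply (Step r1); auto; [lia|]. apply Heads; lia.
    - apply (Step r); [lia|apply Heads; lia|left; apply IH; lia]. }
  apply (Step r2); [lia|apply Heads; lia|exact E2|]. apply Tails; lia.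
Qed.

(* The value of [x] is [2 (R - d x) + m]: the outer neighbours of [x] and its next sibling on the
   run have smaller values, and once they are gone [x] is an SCE point. *)
Lemma value_removed o d R T :
  (forall t, (t <= T)%nat -> metric (Se (C t)) o d) ->
  (forall x, Se (C 0%nat) x -> (d x <= R)%nat) ->
  forall N t, (t <= T)%nat -> round_end n a (2 * (N + 1)) t ->
  forall x u w m, Se (C 0%nat) x -> x <> o -> frame u w -> run (Se (C 0%nat)) d u w x m ->
    (2 * (R - d x) + m <= N)%nat -> ~ Se (C t) x.
Proof.
  intros HG HR. induction N as [N IH] using (well_founded_induction lt_wf).
  intros t Lt Rd x u w m Sx Nxo F Hrun Hval.
  replace (2 * (N + 1))%nat with (Datatypes.S (Datatypes.S (2 * N))) in Rd by lia.
  apply round_split in Rd as (s1 & Rd & C2). apply round_split in Rd as (s & Rd & C1).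
  pose proof (covers_lt _ _ _ _ Hn C1). pose proof (covers_lt _ _ _ _ Hn C2).
  assert (G0 := HG 0%nat ltac:(lia)).
  (* Smaller values have disappeared by the end of round [2 N], two rounds before [t]. *)
  assert (Lower : forall r y u' w' m', (s <= r)%nat -> Se (C 0%nat) y -> y <> o -> frame u' w' ->
    run (Se (C 0%nat)) d u' w' y m' -> (2 * (R - d y) + m' < N)%nat -> ~ Se (C r) y).
  { intros r y u' w' m' Lr Sy Ny F' Hrun' Hv Sr.
    assert (HN : N = (N - 1 + 1)%nat) by lia. rewrite HN in Rd.
    apply (IH (N - 1)%nat ltac:(lia) s ltac:(lia) Rd y u' w' m'); auto; [lia|].
    apply eligible_mono with r; auto. }
  apply SCE_removed with s s1 o; auto.
  2:{ apply origin_in with d. apply HG. auto. }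
  intros r Hr Sr.
  assert (Gr := HG r ltac:(lia)).
  assert (Sub : forall z, Se (C r) z -> Se (C 0%nat) z).
  { intros z. apply eligible_mono. lia. }
  assert (HF : hole_free (Se (C r))) by apply (eligible_shape _ _ _ (execution_invariant r)).
  assert (Childless : forall z, Se (C r) z -> adj x z -> d z <> (d x + 1)%nat).
  { intros z Sz A Dz. assert (Sz0 := Sub z Sz). assert (Dx := HR z Sz0).
    destruct (run_next_level _ _ _ G0 x z u w m) as (u' & w' & F' & Hrun'); auto.
    { repeat split; auto using adj_sym. }
    (* The child has value at most [2 (R - d x - 1) + m + 1]; the bound [d z <= R] keeps the
       subtraction from being truncated. *)
    apply (Lower r z u' w' (Datatypes.S m)); auto; [lia| |lia].
    intros ->. rewrite (origin_zero _ _ _ Gr) in Dz. lia. }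
  destruct Hrun as [x m b One|x m P1 P2 NS|x m P1 P2 XS Hrun].
  - apply (one_parent_SCE (Se (C 0%nat)) (Se (C r)) o d x) with b; auto.
  - apply (run_end_SCE (Se (C 0%nat)) (Se (C r)) o d x) with u w; auto.
    intros _ (Es & As & Ds). apply NS. repeat split; auto.
  - apply (run_end_SCE (Se (C 0%nat)) (Se (C r)) o d x) with u w; auto.
    destruct XS as (Es & _ & Ds). intros Esr _. revert Esr.
    apply Lower with u w m; auto; [lia| |lia].
    intros Q. rewrite Q, (origin_zero _ _ _ G0) in Ds.
    apply Nxo, (zero_origin _ _ _ G0); auto.
Qed.

Lemma alone_all_final s s1 s2 s3 o : covers n a s s1 -> covers n a s1 s2 -> covers n a s2 s3 ->
  (forall x, Se (C s) x -> x = o) -> all_final n (C s3).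
Proof.
  intros C1 C2 C3 Al.
  pose proof (covers_lt _ _ _ _ Hn C1). pose proof (covers_lt _ _ _ _ Hn C2).
  pose proof (covers_lt _ _ _ _ Hn C3).
  assert (Step : forall r p, (s <= r)%nat -> (p < n)%nat ->
    (tail (st (C r) p) = None \/ a r = p -> tail (st (C (Datatypes.S r)) p) = None) /\
    (a r = p -> tail (st (C r) p) = None -> stat (st (C (Datatypes.S r)) p) <> Undecided) /\
    (a r = p -> tail (st (C r) p) = None ->
      (forall q, (q < n)%nat -> stat (st (C r) q) <> Undecided) ->
      final (st (C (Datatypes.S r)) p) = true)).
  { intros r p Lr Hp. destruct (Ex r) as [Ha Hst].
    apply (step_alone K n (C r) (execution_invariant r) p (a r) o); auto.
    intros x Sx. apply Al. apply eligible_mono with r; auto. }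
  assert (Tails : forall p r, (p < n)%nat -> (s1 <= r)%nat -> tail (st (C r) p) = None).
  { intros p r Hp Lr. destruct (C1 p Hp) as (r1 & Hr1 & E1).
    assert (L : (Datatypes.S r1 <= r)%nat) by lia. clear Lr.
    induction L as [|r L IH]; apply Step; auto; lia. }
  assert (Decided : forall p r, (p < n)%nat -> (s2 <= r)%nat -> stat (st (C r) p) <> Undecided).
  { intros p r Hp Lr. destruct (C2 p Hp) as (r1 & Hr1 & E1).
    assert (L : (Datatypes.S r1 <= r)%nat) by lia. clear Lr.
    induction L as [|r L IH].
    - apply Step; auto; [lia|]. apply Tails; auto. lia.
    - destruct (Ex r) as [Ha Hst].
      apply (step_monotone n (C r) p (a r) _ Hp Hst). exact IH. }
  intros p Hp. destruct (C3 p Hp) as (r1 & Hr1 & E1).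
  enough (Final : forall r, (Datatypes.S r1 <= r)%nat -> final (st (C r) p) = true)
    by (apply Final; lia).
  intros r L. induction L as [|r L IH].
  - apply Step; auto; [lia| |].
    + apply Tails; auto. lia.
    + intros q Hq. apply Decided; auto. lia.
  - destruct (Ex r) as [Ha Hst].
    apply (step_monotone n (C r) p (a r) _ Hp Hst). exact IH.
Qed.

Lemma final_mono s t : (s <= t)%nat -> all_final n (C s) -> all_final n (C t).
Proof.
  intros L H. induction L as [|t L IH]; auto. intros p Hp. destruct (Ex t) as [Ha Hst].
  apply (step_monotone n (C t) p (a t) _ Hp Hst). apply IH, Hp.
Qed.
End Execution.

Theorem theorem4p9 :
  exists c : nat,
  forall (n : nat) (pos : nat -> point) (C : nat -> Config) (a : nat -> nat)
         (D t : nat),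
    initial n pos (C 0%nat) ->
    execution n C a ->
    fair n a ->
    diam_le (SP n pos) (area (SP n pos)) D ->
    round_end n a (c * (D + 1))%nat t ->
    all_final n (C t).
Proof.
  (* With radius [3 D] all values are at most [6 D]: erosion takes [2 (6 D + 1)] rounds and
     termination 3 more, in total [12 D + 5]. *)
  exists 12%nat. intros n pos C a D t Hinit Ex _ HD Rd.
  destruct (initial_invariant n pos (C 0%nat) Hinit) as [K I0].
  destruct Hinit as (Hn & _ & _ & HSe & _).
  assert (Lipschitz : forall o d, metric (Se (C 0%nat)) o d ->
    forall x, Se (C 0%nat) x -> (d x <= 3 * D)%nat).
  { intros o d G x Sx. destruct (area_diam _ _ HD o x) as (k & Lk & W).
    - apply HSe, (origin_in _ _ _ G).
    - apply HSe, Sx.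
    - apply (walk_mono _ (Se (C 0%nat))) in W; [|intros z; apply HSe].
      pose proof (metric_walk _ _ _ _ _ _ G W). rewrite (origin_zero _ _ _ G) in H. lia. }
  (* Taking [t] as the horizon makes [o] eligible at every moment considered. *)
  destruct (erosion_metric K t (fun r => Se (C r))) as (o & d & G).
  { apply (execution_erosion K n C a); auto. }
  { apply (eligible_shape _ _ _ I0). }
  { apply (eligible_nonempty _ _ _ I0). }
  assert (G0 := G 0%nat ltac:(lia)).
  replace (12 * (D + 1))%nat with
    ((12 * (D + 1) - (2 * (6 * D + 1) + 3)) + (3 + 2 * (6 * D + 1)))%nat in Rd by lia.
  apply round_prefix in Rd as (s3 & L3 & Rd); [|lia].
  apply round_split in Rd as (s2 & Rd & C3). apply round_split in Rd as (s1 & Rd & C2).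
  apply round_split in Rd as (s & Rd & C1).
  pose proof (covers_lt _ _ _ _ Hn C1). pose proof (covers_lt _ _ _ _ Hn C2).
  pose proof (covers_lt _ _ _ _ Hn C3).
  apply (final_mono n C a Ex s3); auto.
  apply (alone_all_final K n C a Hn I0 Ex s s1 s2 s3 o); auto.
  intros x Sx. apply NNPP. intros Nxo.
  assert (Sx0 : Se (C 0%nat) x).
  { apply (eligible_mono K n C a I0 Ex 0 s); auto. lia. }
  destruct (run_bound _ _ _ G0 x Sx0 Nxo) as (u & w & F & Hrun).
  pose proof (Lipschitz o d G0 x Sx0) as Hd.
  apply (value_removed K n C a Hn I0 Ex o d (3 * D) t) with (N := (6 * D)%nat) (t := s)
    (x := x) (u := u) (w := w) (m := d x); auto; try lia.
  apply Lipschitz with o. exact G0.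
Qed.
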